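(* Consider the $M/M/n$ queue with service rate $\mu>0$ per server and arrival rate $\lambda_n=n\mu(1-\epsilon_n)$, $\epsilon_n\in(0,1)$, and let $r_n$ be the steady-state number of idle servers. Let $\tilde r_n:=r_n-n\epsilon_n$ and $\eta_n:=\frac1{\sqrt{n(1-\epsilon_n)}}$. Let $c>0$ be a constant. (a) (Super-Halfin–Whitt regime) Suppose $\epsilon_n=cn^{-\alpha}$ with $\alpha>\frac12$. Then, if $n^{2\alpha-1}>4c^2$, $$\mathbb P(r_n>0)\le4e\pi c\,n^{-\alpha+\frac12},\qquad\text{and}\qquad \lim_{n\to\infty}\mathbb P(r_n>0)=0;$$ moreover there exists a constant $\kappa_1$, independent of $n$, such that for all $n$ with $n^{2\alpha-1}>4c^2$ and all $x\ge0$, $$\mathbb P(\eta_n\tilde r_n>x)\le\frac{\kappa_1c}{n^{\alpha-\frac12}}\,e^{-\frac12x^2}.$$ (b) (Halfin–Whitt regime) Suppose $\epsilon_n=cn^{-\frac12}$. Then $$\lim_{n\to\infty}\mathbb P(r_n>0)=\frac{\sqrt{2\pi}\,c\,\exp\big(\frac{c^2}{2}\big)\Phi(c)}{1+\sqrt{2\pi}\,c\,\exp\big(\frac{c^2}{2}\big)\Phi(c)},$$ and there exists a constant $\kappa_2$ (independent of $n$) such that for all $n$ with $\epsilon_n<1$ and all $x\ge0$, $$\mathbb P(\eta_n\tilde r_n>x)\le\kappa_2e^{-\frac12x^2}.$$ (c) (Sub-Halfin–Whitt regime) Suppose $\epsilon_n=cn^{-\alpha}$ with $\alpha\in(0,\frac12)$.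 Then there exists a constant $\kappa_3$ (independent of $n$) such that, for all $n$ with $\epsilon_n<1$, $$\mathbb P(r_n>0)\ge1-\frac{\kappa_3}{c}\,n^{\alpha-\frac12}e^{-cn^{\frac12-\alpha}},\qquad \lim_{n\to\infty}\mathbb P(r_n>0)=1,$$ and for all $x\ge0$, $$\mathbb P(\eta_n\tilde r_n>x)\le e^{-\frac12x^2},\qquad \mathbb P(\eta_n\tilde r_n<-x)\le e^{-\frac12x^2+2e\epsilon_nx^2}.$$
   Context: $M/M/n$ queue: $n$ servers, a single first-come-first-served queue, Poisson arrivals of rate $\lambda_n$, independent exponential service times of rate $\mu$ at each server. $q_n(t)$ is the number of customers in the system (a birth–death continuous-time Markov chain with birth rate $\lambda_n$ and death rate $\mu\min\{n,q\}$ in state $q$), positive recurrent when $\lambda_n<n\mu$; $q_n$ denotes a variable with its stationary distribution, and $r_n=[n-q_n]^+$ is the steady-state number of idle servers, with $[y]^+=\max\{y,0\}$. $\Phi$ is the standard normal cumulative distribution function. *)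

(* Defs.v *)
From HB Require Import structures.
From mathcomp Require Import all_boot all_order all_algebra.
From mathcomp Require Import all_classical all_reals all_analysis.

Set Implicit Arguments.
Unset Strict Implicit.
Unset Printing Implicit Defensive.

Import Order.TTheory GRing.Theory Num.Theory.
Import numFieldNormedType.Exports.

Local Open Scope classical_set_scope.
Local Open Scope ring_scope.

(* A family [p t i A = P(X_t \in A | X_0 = i)], [t >= 0], of transition
   probabilities on the countable state space [nat] with infinitesimal
   generator [Q]. The values of [p] at negative times are irrelevant. *)
Record ctmc_semigroup (R : realType) (Q : nat -> nat -> R)
    (p : R -> R.-pker nat ~> nat) : Prop := CtmcSemigroup {
  ctmc_zero : forall i (A : set nat), p 0 i A = \d_i A ;
  ctmc_chapman_kolmogorov : forall s t i (A : set nat), 0 <= s -> 0 <= t ->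
    p (s + t) i A = kcomp_noparam (p s) (p t) i A ;
  ctmc_generator : forall i j,
    (fine (p t i [set j]) - (i == j)%:R) / t @[t --> 0^'+] --> Q i j }.

Definition ctmc_stationary (R : realType) (p : R -> R.-pker nat ~> nat)
    (m : {measure set nat -> \bar R}) : Prop :=
  forall t (A : set nat), 0 <= t -> (\int[m]_i p t i A)%E = m A.

Definition birth_death_rate (R : realType) (birth death : nat -> R)
    (i j : nat) : R :=
  if j == i.+1 then birth i
  else if i == j.+1 then death i
  else if i == j then - (birth i + death i)
  else 0.

(* Generator of the number of customers in system; note that the death rate
   vanishes in state 0. *)
Definition mmn_rate (R : realType) (n : nat) (lam mu : R) : nat -> nat -> R :=
  birth_death_rate (fun=> lam) (fun k => mu * (minn n k)%:R).

(* The law of [q] is a stationary distribution of the M/M/n queue. *)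
Definition mmn_steady_state (R : realType) (n : nat) (lam mu : R)
    d (T : measurableType d) (P : probability T R) (q : {RV P >-> nat}) : Prop :=
  exists2 p : R -> R.-pker nat ~> nat,
    ctmc_semigroup (mmn_rate n lam mu) p & ctmc_stationary p (distribution P q).

(* Truncated subtraction: [n - k]^+. *)
Definition idle (n k : nat) : nat := (n - k)%N.

Definition idle_centered (R : realType) (n : nat) (eps : R) (k : nat) : R :=
  (idle n k)%:R - n%:R * eps.

Definition eta_scale (R : realType) (n : nat) (eps : R) : R :=
  (Num.sqrt (n%:R * (1 - eps)))^-1.

Definition std_normal_cdf (R : realType) (x : R) : R :=
  fine (normal_prob 0 1 `]-oo, x]).

(* Main.v *)
Require Import Defs.
From HB Require Import structures.
From mathcomp Require Import all_boot all_order all_algebra.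
From mathcomp Require Import all_classical all_reals all_analysis.
From mathcomp Require Import measurable_realfun ring lra.

Set Implicit Arguments.
Unset Strict Implicit.
Unset Printing Implicit Defensive.

Import Order.TTheory GRing.Theory Num.Theory.
Import numFieldNormedType.Exports.

Local Open Scope classical_set_scope.
Local Open Scope ring_scope.

(* Stationarity tested on the states [k-1, k, k+1], divided by [t] and sent to
   [t = 0+], shows that the net flow [f k] from [k] to [k+1] is nondecreasing in
   [k]; as [f 0 >= 0] and [f k <= lambda pi_k --> 0], it vanishes, which is detailed
   balance.  With [rho = n (1 - eps)] and
   [u_j = pi_(n-j) / pi_n = prod_(i < j) (1 - i/n) / (1 - eps)],
   [S = sum_(1 <= j <= n) u_j], the geometric tail above [n] gives
   [P(r > 0) = eps S / (1 + eps S)].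
   - The upper tail of [r] is a Poisson lower tail times [G = pi_0 exp rho], where
     [G <= 1] by comparison with the infinite-server queue, and, by Stirling,
     [G = O(eps sqrt n)] when [eps sqrt n <= 1/2].
   - [u_j <= exp (O(1) - j / (2 sqrt n))] bounds [S] in (a).
   - In (b), [S / sqrt n] is the integral over [u <= c] of a step function that
     converges, dominatedly, to [exp (c^2/2 - u^2/2)].
   - In (c), [(1 - eps) u_(j+1) <= u_j] telescopes to [u_j <= 1 + eps S], hence
     [1 + eps S >= exp (n eps^2 / 2)].  For the lower tail at level [theta <= n],
     the same bound is used for the queue with [floor theta + 1] servers, whose
     death rates are smaller. *)

Lemma eq_ler {R : numDomainType} (x y : R) : x = y -> x <= y.
Proof. by move=> ->. Qed.

Lemma summand_cvg0 {R : realType} (a : nat -> R) (l : R) :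
  \sum_(i < k) a i @[k --> \oo] --> l -> a k @[k --> \oo] --> 0.
Proof.
move=> al; rewrite -(subrr l).
have -> : a = fun k => \sum_(i < k.+1) a i - \sum_(i < k) a i.
  by apply/funext => k; rewrite big_ord_recr/= addrAC subrr add0r.
by apply: cvgB => //; rewrite (cvg_shiftS (fun k => \sum_(i < k) a i)).
Qed.

(** * Stationary laws of birth-death chains *)

Section stationary_law.
Context {R : realType}.
Implicit Types (p : R -> R.-pker nat ~> nat) (m : probability nat R).

Lemma singleton_sum_le_integral (m : {measure set nat -> \bar R})
    (f : nat -> \bar R) (s : seq nat) :
  (forall i, 0 <= f i)%E -> uniq s ->
  (\sum_(i <- s) f i * m [set i] <= \int[m]_i f i)%E.
Proof.
move=> f0 us.
rewrite (eq_bigr (fun i => \int[m]_(x in [set i]) f x)%E); last first.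
  move=> i _; rewrite -integral_cst//.
  by apply: eq_integral => x; rewrite inE => ->.
rewrite -ge0_integral_bigsetU//.
  by apply: ge0_subset_integral => //; exact: bigsetU_measurable.
by move=> i j _ _ [x [-> ->]].
Qed.

(** Stationarity restricted to the finite set [s] bounds the sum of [m_i p_t(i, j)] by [m_j];
    subtract [m_j], divide by [t] and let [t] tend to [0+]. An inequality on finitely many states
    avoids exchanging the limit with an infinite sum. *)
Lemma stationary_flow_le0 (Q : nat -> nat -> R) p m (s : seq nat) j :
  ctmc_semigroup Q p -> ctmc_stationary p m -> uniq s -> j \in s ->
  \sum_(i <- s) fine (m [set i]) * Q i j <= 0.
Proof.
move=> [_ _ gen] st us js.
have pfin t i : p t i [set j] \is a fin_num.
  rewrite ge0_fin_numE//; apply: (@le_lt_trans _ _ (p t i setT)).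
    by apply: le_measure; rewrite ?inE.
  by rewrite prob_kernel ltry.
have mfin i : m [set i] \is a fin_num by exact: fin_num_measure.
pose f t := \sum_(i <- s) fine (m [set i]) *
  ((fine (p t i [set j]) - (i == j)%:R) / t).
have cf : f t @[t --> 0^'+] --> \sum_(i <- s) fine (m [set i]) * Q i j.
  rewrite /f; elim: s {us js} @f => [|i s IH] /=.
    by rewrite big_nil; under eq_fun do rewrite big_nil; exact: cvg_cst.
  rewrite big_cons; under eq_fun do rewrite big_cons.
  by apply: cvgD IH; apply: cvgMr; exact: gen.
rewrite -(cvg_lim _ cf)//; apply: limr_le; first by apply: cvgP; exact: cf.
near=> t; have t0 : 0 < t by near: t; exact: nbhs_right_gt.
rewrite /f; under eq_bigr do rewrite mulrA.
rewrite -mulr_suml pmulr_lle0 ?invr_gt0//.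
under eq_bigr do rewrite mulrBr.
rewrite sumrB subr_le0.
rewrite [leRHS](_ : _ = fine (m [set j])); last first.
  rewrite (bigD1_seq j)//= eqxx mulr1 big1 ?addr0// => i /negPf ->.
  by rewrite mulr0.
rewrite -lee_fin fineK// -(st t _ (ltW t0)).
apply: le_trans (singleton_sum_le_integral _ _ us) => //.
rewrite -sumEFin; apply: lee_sum => i _.
by rewrite EFinM !fineK// muleC.
Unshelve. all: by end_near.
Qed.

Lemma mass_below (m : probability nat R) k :
  m [set i | (i < k)%N] = (\sum_(i < k) fine (m [set nat_of_ord i]))%:E.
Proof.
rewrite -sumEFin -(big_mkord xpredT (fun i => (fine (m [set i]))%:E)).
under eq_bigr do rewrite fineK ?fin_num_measure//.
rewrite big_mkord -measure_bigsetU//; last by move=> i j _ _ [x [-> ->]].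
congr (m _); apply/seteqP; split=> [i /= ik|i].
  by rewrite -bigcup_mkord; exists i.
by rewrite -bigcup_mkord => -[j /= jk ->].
Qed.

Lemma mass_below_cvg (m : probability nat R) :
  \sum_(i < k) fine (m [set nat_of_ord i]) @[k --> \oo] --> (1 : R).
Proof.
have -> : (fun k => \sum_(i < k) fine (m [set nat_of_ord i])) =
    fine \o (fun k => m [set i | (i < k)%N]).
  by apply/funext => k /=; rewrite mass_below.
apply: fine_cvg; rewrite -[1%:E](@probability_setT _ _ _ m).
have -> : [set: nat] = \bigcup_k [set i | (i < k)%N].
  by apply/seteqP; split=> // i _; exists i.+1 => /=.
apply: nondecreasing_cvg_mu => //.
by move=> i j ij; apply/subsetPset => k /= ki; exact: leq_trans ki ij.
Qed.

Lemma birth_death_balance (birth death : nat -> R) p m (B : R) :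
  ctmc_semigroup (birth_death_rate birth death) p -> ctmc_stationary p m ->
  death 0 = 0 -> (forall k, 0 <= death k) -> (forall k, birth k <= B) ->
  forall k, birth k * fine (m [set k]) = death k.+1 * fine (m [set k.+1]).
Proof.
move=> sp st d0 dge0 leB; set a := fun k => fine (m [set k]).
have a0 k : 0 <= a k by exact: fine_ge0.
pose f k := birth k * a k - death k.+1 * a k.+1.
(* The column of state [0] lives on [0] and [1]; as [death 0 = 0], its flow inequality is
   [- f 0 <= 0]. *)
have f0 : 0 <= f 0.
  have := @stationary_flow_le0 _ p m [:: 0; 1] 0 sp st erefl erefl.
  rewrite !big_cons big_nil /birth_death_rate /= d0 -!/(a _) /f; lra.
(* The flow inequality for the column of [k.+1], on its three states, reads [f k - f k.+1 <= 0]. *)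
have fS k : f k <= f k.+1.
  have := @stationary_flow_le0 _ p m [:: k; k.+1; k.+2] k.+1 sp st.
  rewrite /= !inE !eqSS !eqxx orbT !andbT !negb_or.
  rewrite !(ltn_eqF, gtn_eqF)// => /(_ erefl erefl).
  rewrite !big_cons big_nil /birth_death_rate !eqSS !eqxx.
  rewrite !(ltn_eqF, gtn_eqF)// -!/(a _) /f; lra.
have /nondecreasing_seqP ndf := fS.
have a_cvg : a k @[k --> \oo] --> 0 := summand_cvg0 (@mass_below_cvg m).
move=> k; apply/eqP; rewrite -!/(a _) -subr_eq0 -/(f k) eq_le; apply/andP; split.
  have Bcvg : B * a k @[k --> \oo] --> 0.
    by rewrite -(mulr0 B); exact: cvgMr.
  rewrite -(cvg_lim _ Bcvg)//; apply: limr_ge; first by apply: cvgP; exact: Bcvg.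
  near=> j; apply: (@le_trans _ _ (f j)).
    by apply: ndf; near: j; exact: nbhs_infty_ge.
  apply: (@le_trans _ _ (birth j * a j)); last by rewrite ler_wpM2r.
  by rewrite /f lerBlDr lerDl mulr_ge0.
by elim: k => // k IH; exact: le_trans (fS k).
Unshelve. all: by end_near.
Qed.

End stationary_law.

(** * Ratios of stationary probabilities *)

Section product_form.
Context {R : realType}.
Implicit Types (m j : nat) (e x : R).

(* [pi_(m-j) / pi_m] for the stationary law [pi] of the M/M/m queue. *)
Definition ratio_prod m e j : R := \prod_(i < j) ((1 - i%:R / m%:R) / (1 - e)).

(** For the M/M/m law this is the mass below [m] divided by [pi_m]; the shift to [j.+1] leaves out
    state [m] itself. *)
Definition ratio_sum m e : R := \sum_(j < m) ratio_prod m e j.+1.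

Lemma ratio_prodS m e j :
  ratio_prod m e j.+1 = ratio_prod m e j * ((1 - j%:R / m%:R) / (1 - e)).
Proof. by rewrite /ratio_prod big_ord_recr. Qed.

Lemma frac_itv m j : (j <= m)%N -> 0 <= (j%:R / m%:R : R) <= 1.
Proof.
case: m => [|m] jm; first by rewrite invr0 mulr0 lexx ler01.
by rewrite divr_ge0// ler_pdivrMr ?ltr0n// mul1r ler_nat.
Qed.

Lemma ratio_prod_ge0 m e j : e < 1 -> (j <= m)%N -> 0 <= ratio_prod m e j.
Proof.
move=> e1 jm; apply: prodr_ge0 => i _.
have /andP[_ h] := frac_itv (leq_trans (ltnW (ltn_ord i)) jm).
by rewrite divr_ge0// subr_ge0// ltW.
Qed.

Lemma ratio_sum_ge0 m e : e < 1 -> 0 <= ratio_sum m e.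
Proof. by move=> e1; apply: sumr_ge0 => i _; exact: ratio_prod_ge0. Qed.

(** Since [(1 - e) u_(j+1) = (1 - j / m) u_j <= u_j], each increment [u_(j+1) - u_j] is at most
    [e u_(j+1)]. *)
Lemma ratio_prod_le_sum m e j : 0 < e < 1 -> (j <= m)%N ->
  ratio_prod m e j <= 1 + e * ratio_sum m e.
Proof.
move=> /andP[e0 e1] jm.
have : ratio_prod m e j <= 1 + e * \sum_(i < j) ratio_prod m e i.+1.
  elim: j jm => [|j IH] jm.
    by rewrite big_ord0 mulr0 addr0 /ratio_prod big_ord0.
  rewrite big_ord_recr/= mulrDr addrA -lerBlDr.
  apply: le_trans (IH (ltnW jm)).
  have -> : ratio_prod m e j.+1 - e * ratio_prod m e j.+1 =
      ratio_prod m e j * (1 - j%:R / m%:R).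
    rewrite ratio_prodS; set t := _ / m%:R.
    by field; rewrite subr_eq0 gt_eqF.
  rewrite ler_piMr ?ratio_prod_ge0 ?(ltnW jm)//.
move=> /le_trans; apply; rewrite lerD2l ler_pM2l//.
rewrite /ratio_sum -(big_mkord xpredT (fun i => ratio_prod m e i.+1)).
rewrite -(big_mkord xpredT (fun i => ratio_prod m e i.+1)).
rewrite (big_cat_nat (n := j) _ jm)//= lerDl big_nat_cond sumr_ge0// => i.
by rewrite andbT => /andP[_ im]; exact: ratio_prod_ge0.
Qed.

Lemma sum_natr j : \sum_(i < j) i%:R = j%:R * (j%:R - 1) / 2 :> R.
Proof.
elim: j => [|j IH]; first by rewrite big_ord0 !mul0r.
by rewrite big_ord_recr/= IH -natr1; field.
Qed.

(** As long as [t = i / m <= e], each factor is at least [exp (e - t)], because [(1 - t) (1 - (e -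
    t)) = 1 - e + t (e - t)]. *)
Lemma ratio_prod_ge m e j : 0 <= e < 1 ->
  (forall i, (i < j)%N -> i%:R / m%:R <= e) ->
  expR (j%:R * e - j%:R * (j%:R - 1) / (2 * m%:R)) <= ratio_prod m e j.
Proof.
move=> /andP[e0 e1] ile.
have -> : j%:R * e - j%:R * (j%:R - 1) / (2 * m%:R) =
    \sum_(i < j) (e - i%:R / m%:R).
  rewrite sumrB sumr_const card_ord -mulr_suml sum_natr invfM.
  by rewrite -[_ *+ j]mulr_natl; ring.
rewrite expR_sum; apply: ler_prod => i _; rewrite expR_ge0/=.
have := ile _ (ltn_ord i); set t := _ / _ => te.
have t0 : 0 <= t by rewrite divr_ge0.
rewrite ler_pdivlMr ?subr_gt0//.
(* [1 - e <= (1 - t) (1 - (e - t)) <= (1 - t) exp (- (e - t))] *)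
have h : 1 - (e - t) <= expR (- (e - t)) by exact: expR_ge1Dx.
rewrite -(@ler_pM2r _ (expR (- (e - t)))) ?expR_gt0//.
rewrite mulrAC expRxMexpNx_1 mul1r.
apply: le_trans (ler_wpM2l _ h); last lra.
nra.
Qed.

(** The left side is [1 + e / (1 - e) <= exp (e / (1 - e))], and [e / (1 - e) <= e + 2 e^2] up to
    [e = 1 / 2]. *)
Lemma onemV_le_expR e : 0 <= e <= 1 / 2 -> (1 - e)^-1 <= expR (e + 2 * e ^+ 2).
Proof.
move=> /andP[e0 e1]; have e1' : 0 < 1 - e by lra.
apply: (@le_trans _ _ (1 + e / (1 - e))).
  by apply: eq_ler; field; rewrite gt_eqF.
apply: (le_trans (expR_ge1Dx _)); rewrite ler_expR ler_pdivrMr//; nra.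
Qed.

(** Factor by factor: [1 - t <= exp (- t)] for the numerator and [onemV_le_expR] for the
    denominator. *)
Lemma ratio_prod_le m e j : 0 <= e <= 1 / 2 -> (j <= m)%N ->
  ratio_prod m e j <=
  expR (j%:R * (e + 2 * e ^+ 2) - j%:R * (j%:R - 1) / (2 * m%:R)).
Proof.
move=> /andP[e0 e1] jm.
have -> : j%:R * (e + 2 * e ^+ 2) - j%:R * (j%:R - 1) / (2 * m%:R) =
    \sum_(i < j) (e + 2 * e ^+ 2 - i%:R / m%:R).
  rewrite sumrB sumr_const card_ord -mulr_suml sum_natr invfM.
  by rewrite -[_ *+ j]mulr_natl; ring.
rewrite expR_sum; apply: ler_prod => i _.
have /andP[] := frac_itv (leq_trans (ltnW (ltn_ord i)) jm).
set t := _ / _ => t0 t1.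
have e1' : 0 < 1 - e by lra.
apply/andP; split; first by rewrite divr_ge0 ?(ltW e1')// subr_ge0.
rewrite ler_pdivrMr//.
rewrite expRD.
have h : 1 - t <= expR (- t) by exact: expR_ge1Dx.
apply: (le_trans h); rewrite [leRHS]mulrAC ler_peMl ?expR_ge0//.
by rewrite -ler_pdivrMr// div1r onemV_le_expR// e0.
Qed.

(** Unlike [ratio_prod_ge], this allows [i / m] beyond [e]: for [t <= 1 / 2] one has
    [1 - t >= exp (- t - 2 t^2)]. Replacing [t] by [j / m] in the square costs an error of order
    [1 / sqrt m] when [j] is of order [sqrt m]. *)
Lemma ratio_prod_ge_half m e j : 0 <= e < 1 -> (j.*2 <= m)%N ->
  expR (j%:R * e - j%:R * (j%:R - 1) / (2 * m%:R)
        - 2 * j%:R * (j%:R / m%:R) ^+ 2) <= ratio_prod m e j.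
Proof.
move=> /andP[e0 e1] jm.
apply: (@le_trans _ _
    (expR (\sum_(i < j) (e - (i%:R / m%:R + 2 * (j%:R / m%:R) ^+ 2))))).
  rewrite ler_expR sumrB sumr_const card_ord big_split/= -mulr_suml sum_natr.
  rewrite sumr_const card_ord invfM -2![_ *+ j]mulr_natl.
  apply: eq_ler; ring.
rewrite expR_sum; apply: ler_prod => i _; rewrite expR_ge0/= expRB.
have jm2 : j%:R / m%:R <= 1 / 2 :> R.
  case: m jm => [|m] jm; first by rewrite invr0 mulr0 divr_ge0.
  rewrite ler_pdivrMr ?ltr0n// mul1r ler_pdivlMl//.
  by rewrite -natrM ler_nat mul2n.
have : i%:R / m%:R <= j%:R / m%:R :> R.
  by rewrite ler_wpM2r// ler_nat ltnW.
set t := i%:R / _ => tj; set s := j%:R / _ in jm2 tj *.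
have t0 : 0 <= t by rewrite divr_ge0.
have e1' : 0 < 1 - e by rewrite subr_gt0.
have t1 : 0 < 1 - t by lra.
rewrite [leRHS]mulrC ler_pM ?invr_ge0 ?expR_ge0//.
  rewrite -[leLHS]invrK lef_pV2 ?posrE ?invr_gt0 ?expR_gt0// -expRN.
  exact: expR_ge1Dx.
rewrite -[leRHS]invrK lef_pV2 ?posrE ?invr_gt0 ?expR_gt0//.
apply: (@le_trans _ _ (1 + t / (1 - t))).
  by apply: eq_ler; field; rewrite gt_eqF.
apply: le_trans (expR_ge1Dx _) _; rewrite ler_expR ler_pdivrMr//.
nra.
Qed.

(* The exponent is the sum of [e - i / m] over [i <= J], [J] the integer part of
   [m e], which dominates the integral of [e - y / m] over [0 <= y <= m e]. *)
Lemma expR_le_ratio_sum m e : (0 < m)%N -> 0 < e < 1 ->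
  expR (m%:R * e ^+ 2 / 2) <= 1 + e * ratio_sum m e.
Proof.
move=> m0 /andP[e0 e1]; set J := Num.truncn (m%:R * e).
have mR : 0 < m%:R :> R by rewrite ltr0n.
have /andP[J1 J2] : J%:R <= m%:R * e < J.+1%:R.
  by apply: truncn_itv; rewrite mulr_ge0// ltW.
have Jm : (J < m)%N.
  by rewrite -(@ltr_nat R); apply: le_lt_trans J1 _; rewrite gtr_pMr.
have e01 : 0 < e < 1 by rewrite e0.
apply: le_trans (ratio_prod_le_sum e01 Jm).
apply: le_trans (ratio_prod_ge _ _); last 2 first.
- by rewrite (ltW e0).
- move=> i; rewrite ltnS => iJ; rewrite ler_pdivrMr// mulrC.
  by apply: le_trans J1; rewrite ler_nat.
rewrite ler_expR; move: J1 J2; rewrite -natr1; move: J%:R => y J1 J2.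
have -> : (y + 1) * e - (y + 1) * (y + 1 - 1) / (2 * m%:R) =
   ((y + 1) * (2 * (m%:R * e)) - (y + 1) * y) / (2 * m%:R).
  by field; rewrite gt_eqF.
rewrite ler_pdivlMr ?mulr_gt0//.
have -> : m%:R * e ^+ 2 / 2 * (2 * m%:R) = (m%:R * e) ^+ 2 by field.
have y0 : 0 < m%:R * e by rewrite mulr_gt0.
(* With [s = z - y] in [[0, 1)], the right side minus the left side is [z + s (1 - s)]. *)
move: (m%:R * e) J1 J2 y0 => z J1 J2 y0; nra.
Qed.

End product_form.

(** * The M/M/n stationary law *)

Section exponential_bounds.
Context {R : realType}.
Implicit Types x : R.

Lemma partial_expR_le x k : 0 <= x -> \sum_(i < k) x ^+ i / i`!%:R <= expR x.
Proof.
move=> x0; rewrite -(big_mkord xpredT (fun i => x ^+ i / i`!%:R)).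
apply: (nondecreasing_cvgn_le (u_ := series (exp_coeff x))).
  by apply/nondecreasing_series => i _ _; rewrite divr_ge0// exprn_ge0.
exact: is_cvg_series_exp_coeff.
Qed.

(** Multiply by [exp x >= 1 + x + x^2 / 2]: the product of the two quadratics is [1 + x^4 / 4]. *)
Lemma expRN_le x : 0 <= x -> expR (- x) <= 1 - x + x ^+ 2 / 2.
Proof.
move=> x0; have := partial_expR_le 3 x0.
rewrite !big_ord_recr big_ord0 /= add0r expr0 !divr1 expr1 expRN.
move: (expR_gt0 x); move: (expR x) => y y0 le.
rewrite -div1r ler_pdivrMr//.
have h : 0 <= 1 - x + x ^+ 2 / 2 by nra.
apply: (le_trans _ (ler_wpM2l h le)).
have -> : (1 - x + x ^+ 2 / 2) * (1 + x + x ^+ 2 / 2`!%:R) = 1 + x ^+ 4 / 4.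
  by rewrite (_ : 2`! = 2)//; field.
by rewrite lerDl divr_ge0// exprn_ge0.
Qed.

(* Markov's inequality for [exp (- s N)], [N] Poisson and [s = x / sqrt rho]. *)
Lemma poisson_lower_tail (rho x : R) k : 0 < rho -> 0 <= x ->
  (forall i, (i < k)%N -> i%:R <= rho - x * Num.sqrt rho) ->
  \sum_(i < k) rho ^+ i / i`!%:R <= expR (rho - x ^+ 2 / 2).
Proof.
move=> rho0 x0 ik; set r := Num.sqrt rho.
have r0 : 0 < r by rewrite sqrtr_gt0.
have rE : rho = r ^+ 2 by rewrite sqr_sqrtr// ltW.
(* The final exponent [rho - s x r + rho s^2 / 2] is smallest at this [s], with value
   [rho - x^2 / 2]. *)
pose s := x / r; have s0 : 0 <= s by rewrite divr_ge0// ltW.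
apply: (@le_trans _ _ (expR (s * (rho - x * r)) *
    \sum_(i < k) (rho * expR (- s)) ^+ i / i`!%:R)).
  rewrite mulr_sumr; apply: ler_sum => i _.
  have -> : expR (s * (rho - x * r)) * ((rho * expR (- s)) ^+ i / i`!%:R) =
      rho ^+ i / i`!%:R * expR (s * (rho - x * r - i%:R)).
    by rewrite exprMn -expRM_natr mulNr (mulrBr s (rho - x * r)) expRD; ring.
  rewrite ler_peMr ?divr_ge0 ?exprn_ge0 ?(ltW rho0)//.
  rewrite -[leLHS]expR0 ler_expR mulr_ge0// subr_ge0; exact: ik.
apply: le_trans (ler_wpM2l (expR_ge0 _) (partial_expR_le _ _)) _.
  by rewrite mulr_ge0// ?expR_ge0// ltW.
rewrite -expRD ler_expR.
apply: le_trans (lerD (lexx _) (ler_wpM2l (ltW rho0) (expRN_le s0))) _.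
apply: eq_ler.
by rewrite /s rE; field; rewrite gt_eqF.
Qed.

End exponential_bounds.

(** * Weights solving the balance equations *)

Section queue_length_law.
Context {R : realType}.
Variables (n : nat) (rho : R) (a : nat -> R).
Hypothesis a_ge0 : forall k, 0 <= a k.
Hypothesis a_sum : \sum_(i < k) a i @[k --> \oo] --> (1 : R).
Hypothesis balance : forall k, rho * a k = (minn n k.+1)%:R * a k.+1.

Lemma below_le1 k : \sum_(i < k) a i <= 1.
Proof.
rewrite -(cvg_lim _ a_sum)//.
apply: (nondecreasing_cvgn_le (u_ := fun k => \sum_(i < k) a i)); last first.
  by apply: cvgP; exact: a_sum.
by apply/nondecreasing_seqP => i; rewrite big_ord_recr/= lerDl.
Qed.

(** The death rates are at most those of the infinite-server queue, whose weights are Poisson, so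
    every ratio [a k.+1 / a k] is at least the Poisson one. *)
Lemma weight_le k : 0 <= rho -> a 0 * (rho ^+ k / k`!%:R) <= a k.
Proof.
move=> rho0; elim: k => [|k IH]; first by rewrite expr0 divr1 mulr1.
have k0 : 0 < k.+1%:R :> R by rewrite ltr0n.
rewrite -(ler_pM2l k0).
apply: (@le_trans _ _ (rho * a k)).
  have -> : k.+1%:R * (a 0 * (rho ^+ k.+1 / (k.+1)`!%:R)) =
      rho * (a 0 * (rho ^+ k / k`!%:R)).
    rewrite factS natrM exprS; field.
    by rewrite nat1r !pnatr_eq0 -lt0n fact_gt0.
  exact: ler_wpM2l.
by rewrite balance ler_wpM2r// ler_nat geq_minr.
Qed.

Lemma weightE k : (k <= n)%N -> a k = a 0 * (rho ^+ k / k`!%:R).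
Proof.
elim: k => [|k IH] kn; first by rewrite expr0 divr1 mulr1.
have k0 : k.+1%:R != 0 :> R by rewrite pnatr_eq0.
apply: (mulfI k0).
have := balance k; rewrite (minn_idPr kn) IH 1?ltnW// => <-.
rewrite factS natrM exprS; field.
by rewrite nat1r !pnatr_eq0 -lt0n fact_gt0.
Qed.

Lemma weight0_le : 0 <= rho -> a 0 * expR rho <= 1.
Proof.
move=> rho0.
have h : a 0 * series (exp_coeff rho) k @[k --> \oo] --> a 0 * expR rho.
  by apply: cvgMr; exact: is_cvg_series_exp_coeff.
rewrite -(cvg_lim _ h)//; apply: limr_le; first by apply: cvgP; exact: h.
apply: nearW => k; apply: le_trans (below_le1 k).
rewrite /series/= big_mkord mulr_sumr; apply: ler_sum => i _.
exact: weight_le.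
Qed.

(** The Poisson form of the weights holds up to state [n] included, hence the range [k <= n.+1]. *)
Lemma below_tail_le (x : R) k : 0 < rho -> 0 <= x -> (k <= n.+1)%N ->
  (forall i, (i < k)%N -> i%:R <= rho - x * Num.sqrt rho) ->
  \sum_(i < k) a i <= a 0 * expR rho * expR (- (x ^+ 2 / 2)).
Proof.
move=> rho0 x0 kn ik; rewrite -mulrA -expRD.
apply: le_trans (ler_wpM2l (a_ge0 0) (poisson_lower_tail rho0 x0 ik)).
rewrite mulr_sumr; apply: ler_sum => i _.
by rewrite weightE// -ltnS (leq_trans _ kn).
Qed.

(** * Mass around a level [m <= n], with the load written as [m (1 - e)] *)

Section below.
Variables (m : nat) (e : R).
Hypotheses (mn : (m <= n)%N) (m_gt0 : (0 < m)%N) (rhoE : rho = m%:R * (1 - e)) (e01 : 0 < e < 1).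

Lemma weight_below j : (j <= m)%N -> a (m - j) = a m * ratio_prod m e j.
Proof.
elim: j => [|j IH] jm; first by rewrite subn0 /ratio_prod big_ord0 mulr1.
have := balance (m - j.+1); rewrite -subSn// subSS (minn_idPr _); last first.
  by rewrite (leq_trans _ mn)// leq_subr.
rewrite IH 1?ltnW// rhoE natrB 1?ltnW// => h.
have m0 : m%:R != 0 :> R by rewrite pnatr_eq0 -lt0n (leq_ltn_trans _ jm).
case/andP: e01 => e0 e1.
have h0 : m%:R * (1 - e) != 0 by rewrite mulf_neq0// subr_eq0 gt_eqF.
apply: (mulfI h0); rewrite h ratio_prodS; field.
by rewrite m0 subr_eq0 gt_eqF.
Qed.

Lemma belowE : \sum_(i < m) a i = a m * ratio_sum m e.
Proof.
rewrite /ratio_sum mulr_sumr -(big_mkord xpredT).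
rewrite -(big_mkord xpredT (fun j => a m * ratio_prod m e j.+1)).
rewrite big_nat_rev/= add0n big_nat_cond [RHS]big_nat_cond.
by apply: eq_bigr => i /andP[/andP[_ im] _]; rewrite weight_below.
Qed.

(** From state [m] on, at least [m] servers work, so [a k.+1 <= (1 - e) a k], that is
    [e a k <= a k - a k.+1], which telescopes from [m]. *)
Lemma above_weight_le : e * (1 - \sum_(i < m) a i) <= a m.
Proof.
have := e01 => /andP[e0 e1].
have aS k : (m <= k)%N -> e * a k <= a k - a k.+1.
  move=> mk; have m_le : (m <= minn n k.+1)%N by rewrite leq_min mn leqW.
  have : m%:R * a k.+1 <= rho * a k by rewrite balance ler_wpM2r// ler_nat.
  rewrite rhoE -mulrA ler_pM2l ?ltr0n// mulrBl mul1r; lra.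
have tele k : e * \sum_(m <= i < k + m) a i <= a m - a (k + m)%N.
  elim: k => [|k IH]; first by rewrite big_geq// mulr0 subrr.
  rewrite addSn big_nat_recr ?leq_addl//= mulrDr.
  have := aS (k + m)%N (leq_addl _ _); lra.
have h : e * (\sum_(i < k + m) a i - \sum_(i < m) a i) @[k --> \oo]
     --> e * (1 - \sum_(i < m) a i).
  apply: cvgMr; apply: cvgB; last exact: cvg_cst.
  by rewrite (cvg_shiftn m (fun k => \sum_(i < k) a i)).
rewrite -(cvg_lim _ h)//; apply: limr_le; first by apply: cvgP; exact: h.
apply: nearW => k; apply: (@le_trans _ _ (a m - a (k + m)%N)); last first.
  by rewrite lerBlDr lerDl.
rewrite -!(big_mkord xpredT a) (big_cat_nat (n := m) _ (leq_addl k m))//=.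
by rewrite addrAC subrr add0r.
Qed.

(** With [F] the mass below [m], [F = a m * S] and [e (1 - F) <= a m] give [e S (1 - F) <= F], that
    is [(1 - F) (1 + e S) <= 1]. *)
Lemma above_le : 1 - \sum_(i < m) a i <= (1 + e * ratio_sum m e)^-1.
Proof.
have /andP[e0 e1] := e01.
have S0 := ratio_sum_ge0 m e1.
rewrite -div1r ler_pdivlMr; last by rewrite ltr_wpDr// mulr_ge0// ltW.
rewrite mulrDr mulr1 mulrA [_ * e]mulrC.
have := ler_wpM2r S0 above_weight_le; rewrite -belowE; lra.
Qed.

End below.

(** At level [n] all servers are busy, the weights above are geometric of ratio [1 - e], and the
    telescoping of [above_weight_le] becomes exact. *)
Lemma above_weightE e : (0 < n)%N -> rho = n%:R * (1 - e) ->
  e * (1 - \sum_(i < n) a i) = a n.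
Proof.
move=> n_gt0 rE.
have aS k : e * a (k + n)%N = a (k + n)%N - a (k.+1 + n)%N.
  have : n%:R * a (k.+1 + n)%N = rho * a (k + n)%N.
    by rewrite balance (minn_idPl _)// -addSn leq_addl.
  by rewrite rE -mulrA => /mulfI; rewrite pnatr_eq0 -lt0n => /(_ n_gt0) ->; ring.
have tele k : e * \sum_(n <= i < k + n) a i = a n - a (k + n)%N.
  elim: k => [|k IH]; first by rewrite big_geq// mulr0 subrr.
  rewrite addSn big_nat_recr ?leq_addl//= mulrDr IH aS; ring.
have h : e * (\sum_(i < k + n) a i - \sum_(i < n) a i) @[k --> \oo]
     --> e * (1 - \sum_(i < n) a i).
  apply: cvgMr; apply: cvgB; last exact: cvg_cst.
  by rewrite (cvg_shiftn n (fun k => \sum_(i < k) a i)).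
apply: (cvg_unique _ h) => //.
have -> : (fun k => e * (\sum_(i < k + n) a i - \sum_(i < n) a i)) =
    (fun k => a n - a (k + n)%N).
  apply/funext => k; rewrite -tele; congr (_ * _).
  rewrite -!(big_mkord xpredT a) (big_cat_nat (n := n) _ (leq_addl k n))//=.
  by rewrite addrAC subrr add0r.
have : a n - a (k + n)%N @[k --> \oo] --> a n - 0.
  apply: cvgB; first exact: cvg_cst.
  by rewrite (cvg_shiftn n a); exact: summand_cvg0 a_sum.
by rewrite subr0.
Qed.

Lemma idle_probE e : (0 < n)%N -> rho = n%:R * (1 - e) -> 0 < e < 1 ->
  \sum_(i < n) a i = e * ratio_sum n e / (1 + e * ratio_sum n e).
Proof.
move=> n0 rhoE e01; have /andP[e0 e1] := e01.
have S0 := ratio_sum_ge0 n e1.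
have := belowE (leqnn n) rhoE e01.
rewrite -(above_weightE n0 rhoE)//.
move: (\sum_(i < n) a i) (ratio_sum n e) S0 => F S S0 FE.
have d0 : 1 + e * S != 0 by rewrite gt_eqF// ltr_wpDr// mulr_ge0// ltW.
apply: (mulIf d0); rewrite mulfVK// mulrDr mulr1 {1}FE; ring.
Qed.

End queue_length_law.

(** * Stirling and Gaussian estimates *)

Section factorial_bound.
Context {R : realType}.

(** The function [(2 + x) exp (- x) + x] has derivative [1 - (1 + x) exp (- x) >= 0] and value [2]
    at [0]; multiply by [exp y] and solve for it. *)
Lemma expR_le_ratio (y : R) : 0 <= y < 2 -> expR y <= (2 + y) / (2 - y).
Proof.
move=> /andP[y0 y2].
pose f (x : R) := (2 + x) * expR (- x) + x.
have df (x : R) : is_derive x 1 f (1 - (1 + x) * expR (- x)).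
  rewrite /f; apply: is_derive_eq; rewrite /GRing.scale/=; ring.
have fle : f 0 <= f y.
  apply: (@ger0_derive1_ndecry _ f 0) => //.
    move=> x; rewrite in_itv/= andbT => x0; rewrite derive1E.
    rewrite (@derive_val _ _ _ _ _ _ _ (df x)) subr_ge0 expRN.
    by rewrite ler_pdivrMr ?expR_gt0// mul1r expR_ge1Dx.
  apply: derivable_within_continuous => x _; exact: ex_derive.
move: fle; rewrite /f oppr0 expR0 expRN => fle.
rewrite ler_pdivlMr ?subr_gt0// mulrC.
have := ler_wpM2r (expR_ge0 y) fle.
have -> : ((2 + y) / expR y + y) * expR y = 2 + y + y * expR y.
  by field; rewrite expR_eq0.
lra.
Qed.

(** Going from [u = n.+1] to [v = u + 1] requires [e <= (v / u)^(u + 1/2)]. Squared, this is the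
    power [2 u + 1] of [expR_le_ratio] at [y = 2 / (2 u + 1)], where [(2 + y) / (2 - y) = v / u]. *)
Lemma fact_le_stirling n : (0 < n)%N ->
  n`!%:R <= expR (1 - n%:R) * (Num.sqrt n%:R * n%:R ^+ n) :> R.
Proof.
case: n => // n _; elim: n => [|n IH].
  by rewrite subrr expR0 sqrtr1 !mul1r expr1n.
rewrite factS natrM.
have n0 : 0 <= n.+2%:R :> R by [].
apply: le_trans (ler_wpM2l n0 IH) _.
have -> : 1 - n.+2%:R = (1 - n.+1%:R) - 1 :> R by rewrite -(natr1 n.+1); ring.
rewrite (expRD (1 - n.+1%:R)) (exprS n.+2%:R).
set u := n.+1%:R; set v := n.+2%:R.
have vE : v = u + 1 by rewrite /v -natr1.
have u1 : 1 <= u by rewrite ler1n.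
have u0 : 0 < u by lra.
have v0 : 0 < v by lra.
suff h : expR 1 * (Num.sqrt u * u ^+ n.+1) <= Num.sqrt v * v ^+ n.+1.
  have -> : expR (1 - u) * expR (-1) * (Num.sqrt v * (v * v ^+ n.+1)) =
      v * (expR (1 - u) * (expR (-1) * (Num.sqrt v * v ^+ n.+1))) by ring.
  rewrite ler_pM2l// ler_pM2l ?expR_gt0// -(ler_pM2l (expR_gt0 1)).
  by rewrite [leRHS]mulrA expRxMexpNx_1 mul1r.
rewrite -(@ler_pXn2r _ 2)// ?nnegrE ?mulr_ge0 ?expR_ge0 ?exprn_ge0 ?sqrtr_ge0 ?(ltW u0) ?(ltW v0)//.
rewrite !exprMn !sqr_sqrtr ?(ltW u0) ?(ltW v0)// -expRM_natl mulr1 -!exprM.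
rewrite -!exprS.
have -> : expR 2%:R = expR (2 / (2 * u + 1)) ^+ (n.+1 * 2).+1 :> R.
  rewrite -expRM_natl; congr expR; rewrite -(natr1 (n.+1 * 2)) natrM -/u; field.
  by rewrite gt_eqF//; lra.
rewrite -exprMn; apply: lerXn2r; rewrite ?nnegrE ?mulr_ge0 ?expR_ge0 ?(ltW u0) ?(ltW v0)//.
have y2 : 0 <= 2 / (2 * u + 1) < 2.
  by rewrite divr_ge0/= ?ltr_pdivrMr; lra.
apply: le_trans (ler_wpM2r (ltW u0) (expR_le_ratio y2)) _.
rewrite vE le_eqVlt; apply/orP; left; apply/eqP; field.
by apply/andP; split; rewrite gt_eqF//; lra.
Qed.

End factorial_bound.

(** * Gaussian and geometric domination of the ratios *)

Section ratio_sum_estimates.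
Context {R : realType}.

(** This is [ratio_prod_le] in the variable [y = j / sqrt n]: the slope [2 Z] comes from
    [2 e^2 <= e], and [1 / 2] from the linear part of [j (j - 1) / (2 n)]. *)
Lemma ratio_prod_gauss n (e Z : R) j : (0 < j <= n)%N -> 0 <= e <= 1 / 2 ->
  e * Num.sqrt n%:R <= Z ->
  ratio_prod n e j <= expR ((2 * Z + 1 / 2) * (j%:R / Num.sqrt n%:R)
                            - (j%:R / Num.sqrt n%:R) ^+ 2 / 2).
Proof.
move=> /andP[j0 jn] e01 eZ; apply: le_trans (ratio_prod_le e01 jn) _.
have n0 : (0 < n)%N by exact: leq_trans jn.
have nE2 : 2 * n%:R = 2 * Num.sqrt n%:R ^+ 2 :> R by rewrite sqr_sqrtr.
have r1 : 1 <= Num.sqrt n%:R :> R by rewrite -[leLHS]sqrtr1 ler_wsqrtr// ler1n.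
rewrite ler_expR [2 * n%:R]nE2; move: r1 eZ; set r := Num.sqrt _ => r1 eZ.
have r0 : r != 0 by rewrite gt_eqF//; lra.
set y := j%:R / r; have -> : j%:R = y * r by rewrite /y mulfVK.
have y0 : 0 <= y by rewrite divr_ge0//; lra.
have -> : y * r * (y * r - 1) / (2 * r ^+ 2) = y ^+ 2 / 2 - y / 2 * r^-1 by field.
have rV : r^-1 <= 1 by rewrite invf_le1//; lra.
have h1 : y / 2 * r^-1 <= y / 2 by rewrite ler_piMr// divr_ge0.
have h2 : y * (r * (e + 2 * e ^+ 2)) <= y * (2 * Z).
  rewrite ler_wpM2l//; case/andP: e01 => e0 e1.
  have e2 : r * (2 * e ^+ 2) <= r * e by rewrite ler_wpM2l//; nra.
  rewrite mulrDr; lra.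
lra.
Qed.

(** By [1 + h <= exp h], each term times [h] is at most a difference of consecutive exponentials,
    and these telescope. *)
Lemma geometric_tail_le n (h : R) : 0 < h ->
  \sum_(j < n) expR (- (h * j.+1%:R)) <= h^-1.
Proof.
move=> h0.
suff : h * (\sum_(j < n) expR (- (h * j.+1%:R))) <= 1 - expR (- (h * n%:R)).
  rewrite -div1r ler_pdivlMr// mulrC => /le_trans; apply.
  by rewrite lerBlDr lerDl expR_ge0.
elim: n => [|n IH]; first by rewrite big_ord0 !mulr0 oppr0 expR0 subrr.
rewrite big_ord_recr/= mulrDr.
suff : h * expR (- (h * n.+1%:R)) <= expR (- (h * n%:R)) - expR (- (h * n.+1%:R)).
  lra.
have -> : - (h * n%:R) = - (h * n.+1%:R) + h by rewrite -natr1; ring.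
rewrite expRD; have := expR_ge1Dx h; have := expR_gt0 (- (h * n.+1%:R)).
move: (expR h) (expR _) => a b; nra.
Qed.

Lemma ratio_sum_le n (e : R) : 0 <= e <= 1 / 2 -> e * Num.sqrt n%:R <= 1 / 2 ->
  ratio_sum n e <= 2 * expR 2 * Num.sqrt n%:R.
Proof.
case: (posnP n) => [->|n0] e01 eZ.
  by rewrite /ratio_sum big_ord0 mulr_ge0// mulr_ge0// expR_ge0.
have r0 : 0 < Num.sqrt n%:R :> R by rewrite sqrtr_gt0 ltr0n.
have h0 : 0 < (2 * Num.sqrt n%:R)^-1 :> R by rewrite invr_gt0 mulr_gt0.
have := geometric_tail_le n h0; rewrite invrK => h.
rewrite -mulrA mulrCA; apply: le_trans (ler_wpM2l (expR_ge0 _) h).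
rewrite mulr_sumr; apply: ler_sum => j _.
apply: le_trans (ratio_prod_gauss _ e01 eZ) _; first by rewrite /= ltn_ord.
rewrite -expRD ler_expR invfM.
have -> : 2^-1 * (Num.sqrt n%:R)^-1 * j.+1%:R = (j.+1%:R / Num.sqrt n%:R) / 2 :> R.
  by field; rewrite gt_eqF.
(* The slope is [2 (1/2) + 1/2 = 3/2], and [(y - 2)^2 >= 0] gives
   [3 y / 2 - y^2 / 2 <= 2 - y / 2]. *)
move: (j.+1%:R / _) => y; have := sqr_ge0 (y - 2); nra.
Qed.

End ratio_sum_estimates.

(** * The Halfin-Whitt limit *)

Section power_decay.
Context {R : realType}.

Lemma powRN_cvg0 (b : R) : 0 < b -> n%:R `^ (- b) @[n --> \oo] --> (0 : R).
Proof.
move=> b0; apply/cvgr0Pnorm_le => e e0; near=> n.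
have n0 : (0 < n)%N by near: n; exact: nbhs_infty_gt.
have en : e^-1 `^ b^-1 <= n%:R by near: n; exact: nbhs_infty_ger.
rewrite ger0_norm ?powR_ge0// powRN -[leRHS]invrK lef_pV2 ?posrE ?invr_gt0//.
  have ei : 0 <= e^-1 by rewrite invr_ge0 ltW.
  have -> : e^-1 = (e^-1 `^ b^-1) `^ b.
    by rewrite -powRrM mulVf ?gt_eqF// powRr1.
  by apply: ge0_ler_powR; rewrite ?nnegrE ?powR_ge0 ?(ltW b0).
by rewrite powR_gt0// ltr0n.
Unshelve. all: by end_near.
Qed.

Lemma powR_half n : n%:R `^ (- (1 / 2)) = (Num.sqrt n%:R)^-1 :> R.
Proof. by rewrite powRN div1r powR12_sqrt. Qed.

Lemma sqrtV_cvg0 : (Num.sqrt n%:R)^-1 @[n --> \oo] --> (0 : R).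
Proof.
by under eq_fun do rewrite -powR_half; apply: powRN_cvg0; rewrite divr_gt0.
Qed.

End power_decay.

Section halfin_whitt_limit.
Context {R : realType}.
Variable c : R.
Hypothesis c_gt0 : 0 < c.
Let mu := @lebesgue_measure R.

Let e n : R := c / Num.sqrt n%:R.

(* The substitution [u = c - j / sqrt n] makes the Gaussian limit a multiple of
   the standard normal density restricted to [u <= c]. *)
Definition ratio_step n (u : R) : R := \sum_(j < n) ratio_prod n (e n) j.+1 *
  \1_(`]c - j.+1%:R / Num.sqrt n%:R, c - j%:R / Num.sqrt n%:R]%classic) u.

Lemma ratio_stepE n u : (0 < n)%N -> u <= c ->
  let J := Num.truncn ((c - u) * Num.sqrt n%:R) in
  ratio_step n u = if (J < n)%N then ratio_prod n (e n) J.+1 else 0.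
Proof.
move=> n0 uc J.
have r0 : 0 < Num.sqrt n%:R :> R by rewrite sqrtr_gt0 ltr0n.
have y0 : 0 <= (c - u) * Num.sqrt n%:R by rewrite mulr_ge0 ?subr_ge0// ltW.
have ind j : \1_(`]c - j.+1%:R / Num.sqrt n%:R, c - j%:R / Num.sqrt n%:R]%classic) u
    = (J == j)%:R :> R.
  rewrite indicE; congr (_%:R); apply: f_equal; apply/idP/idP.
    rewrite inE/= in_itv/= => /andP[h1 h2]; rewrite /J truncn_eq//.
    rewrite -ler_pdivrMr// -ltr_pdivlMr//; apply/andP; split; lra.
  rewrite /J truncn_eq// -ler_pdivrMr// -ltr_pdivlMr// => /andP[h1 h2].
  by rewrite inE/= in_itv/=; apply/andP; split; lra.
rewrite /ratio_step; under eq_bigr do rewrite ind.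
case: ifPn => Jn.
  rewrite (bigD1 (Ordinal Jn))//= eqxx mulr1 big1 ?addr0// => j /negPf jJ.
  by rewrite -val_eqE/= eq_sym in jJ; rewrite jJ mulr0.
rewrite big1// => j _; case: eqP => [Jj|]; last by rewrite mulr0.
by rewrite Jj ltn_ord in Jn.
Qed.

Lemma measurable_ratio_step n (D : set R) : measurable_fun D (ratio_step n).
Proof.
by apply: measurable_sum => j; apply: measurable_funM.
Qed.

Lemma integral_ratio_step n : (0 < n)%N -> e n < 1 ->
  (\int[mu]_(u in `]-oo, c]) (ratio_step n u)%:E =
    (ratio_sum n (e n) / Num.sqrt n%:R)%:E)%E.
Proof.
move=> n0 e1.
have r0 : 0 < Num.sqrt n%:R :> R by rewrite sqrtr_gt0 ltr0n.
under eq_integral do rewrite -sumEFin.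
rewrite ge0_integral_sum//; last 2 first.
- by move=> j; apply/measurable_EFinP; apply: measurable_funM.
- by move=> j u _; rewrite lee_fin mulr_ge0 ?ratio_prod_ge0.
rewrite /ratio_sum mulr_suml -sumEFin; apply: eq_bigr => j _.
under eq_integral do rewrite EFinM.
rewrite ge0_integralZl//; last 2 first.
- exact/measurable_EFinP.
- by rewrite lee_fin ratio_prod_ge0.
rewrite integral_indic// EFinM; congr (_ * _)%E.
rewrite setIidl; last first.
  move=> u /=; rewrite !in_itv/= => /andP[_ /le_trans]; apply.
  by rewrite lerBlDr lerDl divr_ge0// ltW.
rewrite [LHS]lebesgue_measure_itv/= lte_fin.
have -> : c - j.+1%:R / Num.sqrt n%:R < c - j%:R / Num.sqrt n%:R.
  by rewrite ltrD2l ltrN2 ltr_pM2r ?invr_gt0// ltr_nat.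
rewrite -EFinB; congr EFin; rewrite -natr1; field; by rewrite gt_eqF.
Qed.

Lemma e_le (n : nat) : 4 * c ^+ 2 <= n%:R -> 0 <= e n <= 1 / 2.
Proof.
move=> cn; have r0 : 0 < Num.sqrt n%:R :> R.
  by rewrite sqrtr_gt0; apply: lt_le_trans cn; rewrite mulr_gt0// exprn_gt0.
rewrite /e divr_ge0 ?(ltW r0) ?(ltW c_gt0)//= ler_pdivrMr//.
suff : 2 * c <= Num.sqrt n%:R by lra.
rewrite -(@ler_pXn2r _ 2)// ?nnegrE ?(ltW r0) ?mulr_ge0 ?(ltW c_gt0)//.
by rewrite sqr_sqrtr// exprMn -natrX.
Qed.

(** Squeeze between [ratio_prod_ge_half] and [ratio_prod_le]. With [Y = j / sqrt n] and
    [h = 1 / sqrt n], every term of the exponents other than [c Y - Y^2 / 2] carries the factor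
    [Y h], which tends to [0]. *)
Lemma ratio_prod_cvg (j : nat -> nat) (y : R) :
  (j n)%:R / Num.sqrt n%:R @[n --> \oo] --> y ->
  ratio_prod n (e n) (j n) @[n --> \oo] --> expR (c * y - y ^+ 2 / 2).
Proof.
set Y := fun n => (j n)%:R / Num.sqrt n%:R.
pose h n : R := (Num.sqrt n%:R)^-1.
have h0 : h n @[n --> \oo] --> 0 by exact: sqrtV_cvg0.
rewrite -/(Y _) => Yy.
have Yh0 : Y n * h n @[n --> \oo] --> 0.
  by rewrite -[X in _ --> X](mulr0 y); exact: cvgM.
pose lo n := c * Y n - (Y n ^+ 2 - Y n * h n) / 2 - 2 * Y n ^+ 2 * (Y n * h n).
pose up n := c * Y n + 2 * c ^+ 2 * (Y n * h n) - (Y n ^+ 2 - Y n * h n) / 2.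
have lim_sq : (Y n ^+ 2 - Y n * h n) / 2 @[n --> \oo] --> (y ^+ 2 - 0) / 2.
  by apply: cvgMl; apply: cvgB => //; apply: cvgM.
have lo_cvg : expR (lo n) @[n --> \oo] --> expR (c * y - y ^+ 2 / 2).
  apply: continuous_cvg; first exact: continuous_expR.
  have -> : c * y - y ^+ 2 / 2 = c * y - (y ^+ 2 - 0) / 2 - 2 * y ^+ 2 * 0 by ring.
  apply: cvgB; first by apply: cvgB => //; exact: cvgMr.
  by apply: cvgM => //; apply: cvgMr; apply: cvgM.
have up_cvg : expR (up n) @[n --> \oo] --> expR (c * y - y ^+ 2 / 2).
  apply: continuous_cvg; first exact: continuous_expR.
  have -> : c * y - y ^+ 2 / 2 = c * y + 2 * c ^+ 2 * 0 - (y ^+ 2 - 0) / 2 by ring.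
  by apply: cvgB => //; apply: cvgD; exact: cvgMr.
apply: squeeze_cvgr lo_cvg up_cvg; near=> n.
have n0 : (0 < n)%N by near: n; exact: nbhs_infty_gt.
have nR : 0 < n%:R :> R by rewrite ltr0n.
have r0 : 0 < Num.sqrt n%:R :> R by rewrite sqrtr_gt0.
have en : 0 <= e n <= 1 / 2 by apply: e_le; near: n; exact: nbhs_infty_ger.
have nE : n%:R = Num.sqrt n%:R ^+ 2 :> R by rewrite sqr_sqrtr.
have jE : (j n)%:R = Y n * Num.sqrt n%:R :> R by rewrite /Y mulfVK// gt_eqF.
(* Here [Y n * h n] is [j n / n], eventually at most [1 / 2]. *)
have jn : ((j n).*2 <= n)%N.
  have : Y n * h n <= 1 / 2 by near: n; apply: (cvgr_le 0) => //; rewrite divr_gt0.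
  rewrite /Y /h -mulrA -invfM -expr2 -nE ler_pdivrMr// => jn.
  rewrite -(@ler_nat R) -mul2n natrM; lra.
have jn' : (j n <= n)%N by apply: leq_trans jn; rewrite -addnn leq_addr.
have loE : lo n = (j n)%:R * e n - (j n)%:R * ((j n)%:R - 1) / (2 * n%:R)
        - 2 * (j n)%:R * ((j n)%:R / n%:R) ^+ 2.
  rewrite jE /lo /e /h; move: (Y n) nE r0; set r := Num.sqrt _ => z -> r0.
  by field; rewrite gt_eqF.
have upE : up n = (j n)%:R * (e n + 2 * e n ^+ 2)
    - (j n)%:R * ((j n)%:R - 1) / (2 * n%:R).
  rewrite jE /up /e /h; move: (Y n) nE r0; set r := Num.sqrt _ => z -> r0.
  by field; rewrite gt_eqF.
rewrite loE upE ratio_prod_le// andbT ratio_prod_ge_half//.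
by case/andP: en => -> /=; lra.
Unshelve. all: by end_near.
Qed.

Lemma ratio_step_cvg u : u <= c ->
  ratio_step n u @[n --> \oo] --> expR (c ^+ 2 / 2 - u ^+ 2 / 2).
Proof.
move=> uc; pose j n := (Num.truncn ((c - u) * Num.sqrt n%:R)).+1.
have y0 : 0 <= c - u by rewrite subr_ge0.
have Yc : (j n)%:R / Num.sqrt n%:R @[n --> \oo] --> c - u.
  have up : c - u + (Num.sqrt n%:R)^-1 @[n --> \oo] --> c - u.
    rewrite -[X in _ --> X]addr0; apply: cvgD; first exact: cvg_cst.
    exact: sqrtV_cvg0.
  apply: squeeze_cvgr up; last exact: cvg_cst.
  near=> n.
  have n0 : (0 < n)%N by near: n; exact: nbhs_infty_gt.
  have r0 : 0 < Num.sqrt n%:R :> R by rewrite sqrtr_gt0 ltr0n.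
  have /andP[h1 h2] : (Num.truncn ((c - u) * Num.sqrt n%:R))%:R
      <= (c - u) * Num.sqrt n%:R < (j n)%:R.
    by apply: truncn_itv; rewrite mulr_ge0// ltW.
  rewrite ler_pdivlMr// (ltW h2)/= ler_pdivrMr// mulrDl mulVf ?gt_eqF//.
  by rewrite -natr1 lerD2r.
have -> : c ^+ 2 / 2 - u ^+ 2 / 2 = c * (c - u) - (c - u) ^+ 2 / 2 by field.
have := ratio_prod_cvg Yc; apply: cvg_trans; apply: near_eq_cvg; near=> n.
have n0 : (0 < n)%N by near: n; exact: nbhs_infty_gt.
rewrite ratio_stepE// ifT// -(@ltr_nat R).
have r0 : 0 < Num.sqrt n%:R :> R by rewrite sqrtr_gt0 ltr0n.
(* Once [sqrt n] exceeds [c - u], the index [J <= (c - u) sqrt n] is below [n], so [u] lies in one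
   of the steps. *)
have : (c - u) < Num.sqrt n%:R.
  have : ((c - u) ^+ 2 + 1) <= n%:R by near: n; exact: nbhs_infty_ger.
  move=> h; rewrite -(@ltr_pXn2r _ 2)// ?nnegrE ?(ltW r0)// sqr_sqrtr//; lra.
move=> h; apply: (@le_lt_trans _ _ ((c - u) * Num.sqrt n%:R)).
  by rewrite truncn_le mulr_ge0// ltW.
by rewrite -[ltRHS](@sqr_sqrtr R)// expr2 ltr_pM2r.
Unshelve. all: by end_near.
Qed.

(** The slope in [ratio_prod_gauss] at [Z = c], as [e n * sqrt n = c]. *)
Let k := 2 * c + 1 / 2.

(** With [w = c - u], the index of the step satisfies [w <= Y <= w + 1], so the exponent is at most
    [k (w + 1) - w^2 / 2]. Completing the square gives a Gaussian centred at [u = c - k], which is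
    the integrable bound for dominated convergence. *)
Lemma ratio_step_itv n u : 4 * c ^+ 2 <= n%:R -> u <= c ->
  0 <= ratio_step n u <=
  expR (k + k ^+ 2 / 2) / normal_peak 1 * normal_pdf (c - k) 1 u.
Proof.
move=> cn uc; have /andP[e0 e1] := e_le cn.
have nR : 0 < n%:R :> R by apply: lt_le_trans cn; rewrite mulr_gt0// exprn_gt0.
have n0 : (0 < n)%N by rewrite -(@ltr0n R).
have r0 : 0 < Num.sqrt n%:R :> R by rewrite sqrtr_gt0.
have p0 : normal_peak 1 != 0 :> R by rewrite gt_eqF// normal_peak_gt0.
have -> : expR (k + k ^+ 2 / 2) / normal_peak 1 * normal_pdf (c - k) 1 u =
    expR (k + k ^+ 2 / 2 - (u - (c - k)) ^+ 2 / 2).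
  rewrite normal_pdfE ?oner_eq0// mulrA mulfVK// /normal_fun -expRD expr1n.
  by congr expR; rewrite mulNr.
rewrite ratio_stepE//=; set J := Num.truncn _; case: ifPn => [Jn|_]; last first.
  by rewrite lexx expR_ge0.
rewrite ratio_prod_ge0//=; last lra.
apply: le_trans (@ratio_prod_gauss _ _ _ c _ _ _ _) _ => //.
- by rewrite e0.
- by rewrite /e mulfVK// gt_eqF.
have /andP[h1 h2] : J%:R <= (c - u) * Num.sqrt n%:R < J.+1%:R.
  by apply: truncn_itv; rewrite mulr_ge0// ?subr_ge0// ltW.
have r1 : 1 <= Num.sqrt n%:R :> R by rewrite -[leLHS]sqrtr1 ler_wsqrtr// ler1n.
rewrite ler_expR -/k; set Y := _ / _.
have Y1 : c - u <= Y by rewrite /Y ler_pdivlMr// ltW.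
have Y2 : Y <= c - u + 1.
  by rewrite /Y ler_pdivrMr// -natr1 mulrDl mul1r lerD.
have k0 : 0 < k by rewrite /k; move: c_gt0; lra.
have : k * Y <= k * (c - u + 1) by rewrite ler_pM2l.
have : (c - u) ^+ 2 <= Y ^+ 2.
  by apply: lerXn2r => //; rewrite nnegrE ?subr_ge0// (le_trans _ Y1)// subr_ge0.
have -> : u - (c - k) = k - (c - u) by ring.
by rewrite sqrrB; lra.
Qed.

Lemma ratio_sum_cvg : ratio_sum n (e n) / Num.sqrt n%:R @[n --> \oo] -->
  Num.sqrt (2 * pi) * expR (c ^+ 2 / 2) * std_normal_cdf c.
Proof.
(* The domination needs [4 c^2 <= n]; shifting the sequence by [N] makes it hold at every index. *)
pose N := (Num.truncn (4 * c ^+ 2)).+1.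
have Nle m : 4 * c ^+ 2 <= (m + N)%:R.
  apply: (@le_trans _ _ N%:R); last by rewrite ler_nat leq_addl.
  exact/ltW/truncnS_gt.
have peakE : normal_peak 1 = (Num.sqrt (2 * pi))^-1 :> R.
  by rewrite /normal_peak expr1n mul1r mulr_natl.
have pi2 : 0 < Num.sqrt (2 * pi) :> R by rewrite sqrtr_gt0 mulr_gt0// pi_gt0.
set K := Num.sqrt (2 * pi) * expR (c ^+ 2 / 2).
have K0 : 0 <= K by rewrite mulr_ge0 ?expR_ge0// ltW.
have gE u : expR (c ^+ 2 / 2 - u ^+ 2 / 2) = K * normal_pdf 0 1 u.
  rewrite normal_pdfE ?oner_eq0// peakE /normal_fun subr0 expr1n mulNr expRD /K.
  by field; rewrite gt_eqF.
have mpdf (m s : R) (D : set R) : measurable_fun D (normal_pdf m s).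
  by apply: measurable_funTS; exact: measurable_normal_pdf.
have ipdf (m s : R) : mu.-integrable `]-oo, c] (EFin \o normal_pdf m s).
  by apply: integrableS (integrable_normal_pdf m s).
have lim : (\int[mu]_(u in `]-oo, c]) (ratio_step (m + N) u)%:E)%E @[m --> \oo]
    --> (\int[mu]_(u in `]-oo, c]) (K * normal_pdf 0 1 u)%:E)%E.
  apply: (@dominated_cvg _ _ R mu `]-oo, c]%classic _
    (fun m u => (ratio_step (m + N) u)%:E) _ (fun u => (expR (k + k ^+ 2 / 2) /
    normal_peak 1 * normal_pdf (c - k) 1 u)%:E)) => //.
  - by move=> m; apply/measurable_EFinP; exact: measurable_ratio_step.
  - move=> u; rewrite /= in_itv/= => uc; apply: cvg_EFin; first exact: nearW.
    rewrite -gE; have := ratio_step_cvg uc.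
    by rewrite -(cvg_shiftn N).
  - exact: (integrableZl _ (expR (k + k ^+ 2 / 2) / normal_peak 1)
      (ipdf (c - k) 1)).
  - move=> m u; rewrite /= in_itv/= => uc; rewrite lee_fin.
    have /andP[h1 h2] := ratio_step_itv (Nle m) uc.
    by rewrite ger0_norm.
rewrite -(cvg_shiftn N); move: lim.
rewrite (_ : (\int[mu]_(u in `]-oo, c]) (K * normal_pdf 0 1 u)%:E)%E =
   (K * std_normal_cdf c)%:E); last first.
  under eq_integral do rewrite EFinM.
  rewrite ge0_integralZl//; last 2 first.
  - by apply/measurable_EFinP; exact: mpdf.
  - by move=> u _; rewrite lee_fin normal_pdf_ge0.
  by rewrite [RHS]EFinM /std_normal_cdf fineK//; apply: fin_num_measure.
move=> /fine_cvg; apply: cvg_trans; apply: near_eq_cvg; apply: nearW => m /=.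
rewrite integral_ratio_step//=; first by rewrite addn_gt0 orbT.
by have /andP[_] := e_le (Nle m); lra.
Qed.

End halfin_whitt_limit.

(** * Tail bounds for the number of idle servers *)

Section mmn_bounds.
Context {R : realType} {d} {T : measurableType d} {P : probability T R}.
Variables (n : nat) (mu e : R) (q : {RV P >-> nat}).
Hypotheses (n_gt0 : (0 < n)%N) (mu_gt0 : 0 < mu) (e01 : 0 < e < 1).
Hypothesis steady : mmn_steady_state n (n%:R * mu * (1 - e)) mu q.

Let m : probability nat R := distribution P q.
Let a k : R := fine (m [set k]).
Let rho : R := n%:R * (1 - e).

Let a_ge0 k : 0 <= a k. Proof. exact: fine_ge0. Qed.

Let rho_gt0 : 0 < rho.
Proof. by case/andP: e01 => _ e1; rewrite mulr_gt0 ?ltr0n ?subr_gt0. Qed.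

Let balance k : rho * a k = (minn n k.+1)%:R * a k.+1.
Proof.
have [p sp st] := steady.
apply: (mulfI (lt0r_neq0 mu_gt0)); rewrite !mulrA.
rewrite -(birth_death_balance sp st _ _ (fun=> lexx _)); last 2 first.
- by rewrite minn0 mulr0.
- by move=> j; rewrite mulr_ge0// ltW.
by rewrite /= /rho -/(a k); ring.
Qed.

Let below_mass k : m [set i | (i < k)%N] = (\sum_(i < k) a i)%:E.
Proof. exact: mass_below. Qed.

Lemma mmn_idle_prob : P [set w | (0 < idle n (q w))%N] =
  (e * ratio_sum n e / (1 + e * ratio_sum n e))%:E.
Proof.
rewrite -[LHS]/(m [set k | (0 < idle n k)%N]).
have -> : [set k | (0 < idle n k)%N] = [set k | (k < n)%N].
  by apply/seteqP; split=> k /=; rewrite subn_gt0.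
by rewrite below_mass (idle_probE (@mass_below_cvg _ m) balance n_gt0 erefl e01).
Qed.

Lemma mmn_upper_tail : exists G : R,
  [/\ 0 <= G <= 1, G <= e * (n`!%:R * expR rho / rho ^+ n) &
   forall x, 0 <= x ->
   (P [set w | (x < eta_scale n e * idle_centered n e (q w))%R] <=
     (G * expR (- (1 / 2 * x ^+ 2)))%:E)%E].
Proof.
have /andP[e0 e1] := e01.
have nR : 0 < n%:R :> R by rewrite ltr0n.
have asum : \sum_(i < k) a i @[k --> \oo] --> (1 : R) := @mass_below_cvg _ m.
exists (a 0 * expR rho); split.
- by rewrite mulr_ge0 ?expR_ge0//= (weight0_le a_ge0 asum balance)// ltW.
- have := above_weightE asum balance n_gt0 erefl.
  rewrite (weightE balance (leqnn n)) => h.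
  (* This is [a n], equal to [e] times the mass of the states from [n] on. *)
  have : a 0 * (rho ^+ n / n`!%:R) <= e.
    by rewrite -h ler_piMr ?(ltW e0)// lerBlDr lerDl sumr_ge0.
  have f0 : 0 < n`!%:R :> R by rewrite ltr0n fact_gt0.
  have c0 : 0 < n`!%:R * expR rho / rho ^+ n :> R.
    by rewrite divr_gt0 ?mulr_gt0 ?expR_gt0 ?exprn_gt0.
  rewrite -(ler_pM2r c0) => /(le_trans _); apply.
  apply: eq_ler; field.
  by rewrite (gt_eqF f0) (gt_eqF (exprn_gt0 n rho_gt0)).
move=> x x0.
rewrite -[leLHS]/(m [set k | (x < eta_scale n e * idle_centered n e k)%R]).
set r := Num.sqrt rho.
have r0 : 0 < r by rewrite sqrtr_gt0.
pose t := rho - x * r.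
have evt k : x < eta_scale n e * idle_centered n e k -> k%:R < t.
  rewrite /eta_scale -/rho -/r ltr_pdivlMl// /idle_centered /idle => h.
  have : (k < n)%N.
    (* A state [k >= n] has no idle server, so its scaled deviation is nonpositive and cannot exceed
       [x]. *)
    rewrite ltnNge; apply/negP => nk; move: h.
    rewrite (eqP nk) sub0r ltNge => /negP; apply.
    by apply: (@le_trans _ _ 0); rewrite ?oppr_le0 mulr_ge0// ltW.
  by move=> kn; move: h; rewrite natrB 1?ltnW// /t /rho; lra.
(* Negative [t] is set apart: its truncation is [0], and state [0] would wrongly be kept. *)
have [t0|t0] := ltP t 0.
  have -> : [set k | (x < eta_scale n e * idle_centered n e k)%R] = set0.
    apply/seteqP; split=> k //= /evt kt.
    by have := lt_trans kt t0; rewrite ltNge ler0n.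
  by rewrite measure0 lee_fin !mulr_ge0 ?expR_ge0.
have -> : 1 / 2 * x ^+ 2 = x ^+ 2 / 2 by field.
apply: (@le_trans _ _ (m [set k | (k < (Num.truncn t).+1)%N])).
  apply: le_measure; rewrite ?inE//= => k /= /evt kt.
  by rewrite ltnS truncn_ge_nat// ltW.
rewrite below_mass lee_fin; apply: (below_tail_le a_ge0 balance) => //.
- rewrite ltnS -(@ler_nat R); apply: (@le_trans _ _ t); first by rewrite truncn_le.
  apply: (@le_trans _ _ rho).
    by rewrite /t lerBlDr lerDl mulr_ge0// ltW.
  by rewrite /rho ler_piMr// ?(ltW nR)// lerBlDr lerDl ltW.
- by move=> i; rewrite ltnS truncn_ge_nat.
Qed.

(** The event forces [q > theta = rho + x sqrt rho]. Put [k0 = floor theta + 1] and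
    [rho = k0 (1 - e')], so that [k0 e' = k0 - rho >= x sqrt rho]. The bound [exp (- k0 e'^2 / 2)]
    then suffices, since [(k0 e')^2 >= x^2 rho >= x^2 k0 (1 - e)]. *)
Lemma mmn_lower_tail x : 0 <= x ->
  (P [set w | (eta_scale n e * idle_centered n e (q w) < - x)%R] <=
    (expR (- ((1 - e) * x ^+ 2 / 2)))%:E)%E.
Proof.
move=> x0; have /andP[e0 e1] := e01.
rewrite -[leLHS]/(m [set k | (eta_scale n e * idle_centered n e k < - x)%R]).
have asum : \sum_(i < k) a i @[k --> \oo] --> (1 : R) := @mass_below_cvg _ m.
have nR : 0 < n%:R :> R by rewrite ltr0n.
set r := Num.sqrt rho.
have r0 : 0 < r by rewrite sqrtr_gt0.
have rE : rho = r ^+ 2 by rewrite sqr_sqrtr// ltW.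
have evt k : eta_scale n e * idle_centered n e k < - x ->
    (idle n k)%:R < n%:R * e - x * r.
  rewrite /eta_scale -/rho -/r ltr_pdivrMl// /idle_centered => h; lra.
(* In the first case the number of idle servers would be negative; in the second, [theta < n] and
   hence [k0 <= n]. *)
have [xr|xr] := leP (n%:R * e) (x * r).
  have -> : [set k | (eta_scale n e * idle_centered n e k < - x)%R] = set0.
    apply/seteqP; split=> k //= /evt; rewrite ltNge => /negP; apply.
    by apply: (@le_trans _ _ 0); rewrite ?ler0n// subr_le0.
  by rewrite measure0 lee_fin expR_ge0.
pose theta := rho + x * r.
have xr0 : 0 <= x * r by rewrite mulr_ge0// ltW.
have th0 : 0 <= theta by rewrite addr_ge0// ltW.
set k0 := (Num.truncn theta).+1.
have k0n : (k0 <= n)%N.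
  by rewrite truncn_lt_nat// /theta /rho; lra.
have k0R : theta < k0%:R by exact: truncnS_gt.
have k0gt : 0 < k0%:R :> R by rewrite ltr0n.
pose e' := 1 - rho / k0%:R.
have rhoE' : rho = k0%:R * (1 - e') by rewrite /e' opprB addrCA subrr addr0 mulrC mulfVK// gt_eqF.
have e'01 : 0 < e' < 1.
  rewrite /e' subr_gt0 ltr_pdivrMr// mul1r (le_lt_trans _ k0R) ?lerDl//=.
  by rewrite ltrBlDr ltrDl divr_gt0.
apply: (@le_trans _ _ (m (~` [set k | (k < k0)%N]))).
  apply: le_measure; rewrite ?inE//= => k /= /evt h; apply/negP.
  rewrite -leqNgt /k0 truncn_lt_nat// /theta.
  have : n%:R - k%:R <= (idle n k)%:R :> R.
    by rewrite lerBlDr -natrD ler_nat addnC -leq_subLR.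
  by rewrite /rho; lra.
rewrite probability_setC//.
rewrite below_mass -EFinB lee_fin.
apply: le_trans (above_le a_ge0 asum balance k0n _ rhoE' e'01) _ => //.
rewrite expRN lef_pV2 ?posrE ?expR_gt0//; last first.
  apply: lt_le_trans (expR_le_ratio_sum _ e'01); first exact: expR_gt0.
  by [].
apply: le_trans (expR_le_ratio_sum _ e'01) => //.
rewrite ler_expR ler_pM2r// -(ler_pM2l k0gt).
have h1 : x * r <= k0%:R * e'.
  by rewrite /e' mulrBr mulr1 mulrCA mulfV ?gt_eqF// mulr1 lerBrDl ltW.
have h2 : k0%:R * (1 - e) <= r ^+ 2.
  by rewrite -rE /rho ler_pM2r ?subr_gt0// ler_nat.
have h3 : (x * r) ^+ 2 <= (k0%:R * e') ^+ 2.
  by apply: lerXn2r; rewrite // nnegrE// (le_trans xr0).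
apply: (@le_trans _ _ ((x * r) ^+ 2)).
  by rewrite mulrA exprMn [leRHS]mulrC ler_wpM2r ?sqr_ge0.
by apply: (le_trans h3); rewrite exprMn expr2 -mulrA.
Qed.

End mmn_bounds.

(** * Bounds in terms of [e * sqrt n] *)

Section regime_estimates.
Context {R : realType}.
Implicit Types (e c z alpha : R) (n : nat).

(** Stirling leaves [sqrt n * exp (1 - n e) / (1 - e)^n]. Since
    [(1 - e)^(-n) <= exp (n (e + 2 e^2))] and [2 n e^2 <= 1 / 2], the exponents add up to at most
    [3 / 2]. *)
Lemma weight0_bound n e : (0 < n)%N -> 0 <= e <= 1 / 2 ->
  e * Num.sqrt n%:R <= 1 / 2 ->
  n`!%:R * expR (n%:R * (1 - e)) / (n%:R * (1 - e)) ^+ n <=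
    expR (3 / 2) * Num.sqrt n%:R.
Proof.
move=> n0 /andP[e0 e1] ez.
have nR : 0 < n%:R :> R by rewrite ltr0n.
have e1' : 0 < 1 - e by lra.
have r0 : 0 < Num.sqrt n%:R :> R by rewrite sqrtr_gt0.
rewrite ler_pdivrMr ?exprn_gt0 ?mulr_gt0//.
apply: le_trans (ler_wpM2r (expR_ge0 _) (fact_le_stirling n0)) _.
have en : expR (- (n%:R * (e + 2 * e ^+ 2))) <= (1 - e) ^+ n.
  rewrite -mulrN expRM_natl; apply: lerXn2r; rewrite ?nnegrE ?expR_ge0 ?(ltW e1')//.
  by rewrite expRN -[leRHS]invrK lef_pV2 ?posrE ?expR_gt0 ?invr_gt0// onemV_le_expR// e0.
rewrite exprMn.
have ne2 : n%:R * e ^+ 2 <= 1 / 4.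
  have -> : n%:R * e ^+ 2 = (e * Num.sqrt n%:R) ^+ 2.
    by rewrite exprMn sqr_sqrtr// mulrC.
  have : 0 <= e * Num.sqrt n%:R by rewrite mulr_ge0// ltW.
  by move: ez; move: (e * _) => z; nra.
apply: (@le_trans _ _ (expR (3 / 2) * Num.sqrt n%:R *
    (n%:R ^+ n * expR (- (n%:R * (e + 2 * e ^+ 2)))))); last first.
  by rewrite ler_wpM2l ?mulr_ge0 ?expR_ge0 ?(ltW r0)// ler_wpM2l// exprn_ge0.
have -> : expR (1 - n%:R) * (Num.sqrt n%:R * n%:R ^+ n) * expR (n%:R * (1 - e)) =
    Num.sqrt n%:R * n%:R ^+ n * expR (1 - n%:R * e).
  have -> : 1 - n%:R * e = (1 - n%:R) + n%:R * (1 - e) by ring.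
  by rewrite (expRD (1 - n%:R)); ring.
have -> : expR (3 / 2) * Num.sqrt n%:R *
    (n%:R ^+ n * expR (- (n%:R * (e + 2 * e ^+ 2)))) =
    Num.sqrt n%:R * n%:R ^+ n * expR (3 / 2 - n%:R * (e + 2 * e ^+ 2)).
  by rewrite (expRD (3 / 2)); ring.
rewrite ler_wpM2l ?mulr_ge0 ?exprn_ge0 ?(ltW r0)// ler_expR; lra.
Qed.

(** Combine [z <= exp z] with [2 z - z^2 / 2 <= 2]. This brings the Gaussian bound on
    [1 / (1 + e S)] to the form stated in (c). *)
Lemma expR_gauss_le z : 0 < z -> expR (- (z ^+ 2 / 2)) <= expR 2 / z * expR (- z).
Proof.
move=> z0; rewrite [leRHS]mulrAC ler_pdivlMr// mulrC -expRD.
apply: (@le_trans _ _ (expR z * expR (- (z ^+ 2 / 2)))).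
  by rewrite ler_wpM2r ?expR_ge0// (le_trans _ (expR_ge1Dx z))// lerDr.
rewrite -expRD ler_expR; have := sqr_ge0 (z - 2); nra.
Qed.

Lemma powR_sqrt n c alpha : (0 < n)%N ->
  c * n%:R `^ (- alpha) * Num.sqrt n%:R = c * n%:R `^ (- alpha + 1 / 2).
Proof.
move=> n0; rewrite powRD ?pnatr_eq0 -?lt0n ?n0 ?implybT// mulrA.
by rewrite div1r powR12_sqrt.
Qed.

Lemma odds_bounds (A : R) : 0 <= A ->
  A / (1 + A) <= A /\ A / (1 + A) = 1 - (1 + A)^-1.
Proof.
move=> A0; have A1 : 0 < 1 + A by rewrite ltr_wpDr.
split; last by field; rewrite gt_eqF.
by rewrite ler_pdivrMr// ler_peMr// lerDl.
Qed.

Lemma odds_le n e : (0 < n)%N -> 0 < e -> e * Num.sqrt n%:R <= 1 / 2 ->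
  e * ratio_sum n e / (1 + e * ratio_sum n e) <=
    4 * expR 1 * pi * (e * Num.sqrt n%:R).
Proof.
move=> n0 e0 ez.
have r1 : 1 <= Num.sqrt n%:R :> R by rewrite -[leLHS]sqrtr1 ler_wsqrtr// ler1n.
have e1 : e <= 1 / 2.
  by apply: le_trans ez; rewrite ler_peMr// ltW.
have e01 : 0 <= e <= 1 / 2 by rewrite (ltW e0).
have S0 : 0 <= ratio_sum n e by apply: ratio_sum_ge0; lra.
have A0 : 0 <= e * ratio_sum n e by rewrite mulr_ge0// ltW.
apply: (le_trans (odds_bounds A0).1).
apply: le_trans (ler_wpM2l (ltW e0) (ratio_sum_le e01 ez)) _.
have r0 : 0 <= e * Num.sqrt n%:R by rewrite mulr_ge0 ?ltW//; lra.
rewrite mulrCA ler_wpM2r//.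
have -> : expR 2 = expR 1 * expR 1 :> R by rewrite -expRD.
(* The constant [2 exp 2] of [ratio_sum_le] is at most [4 e pi], because [e <= 3 <= 2 pi]. *)
have e3 : expR 1 <= 2 * pi :> R.
  have : expR 1 <= (2 + 1) / (2 - 1) :> R by apply: expR_le_ratio; lra.
  have -> : 2 - 1 = 1 :> R by ring.
  have := @pi_ge2 R; lra.
have -> : 4 * expR 1 * pi = 2 * (expR 1 * (2 * pi)) :> R by ring.
by rewrite ler_pM2l// ler_pM2l// expR_gt0.
Qed.

Lemma lower_odds_ge n e : (0 < n)%N -> 0 < e < 1 ->
  1 - expR 2 / (e * Num.sqrt n%:R) * expR (- (e * Num.sqrt n%:R)) <=
    e * ratio_sum n e / (1 + e * ratio_sum n e).
Proof.
move=> n0 e01; have /andP[e0 e1] := e01.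
have A0 : 0 <= e * ratio_sum n e by rewrite mulr_ge0 ?ratio_sum_ge0// ltW.
rewrite (odds_bounds A0).2 lerD2l lerN2.
have z0 : 0 < e * Num.sqrt n%:R by rewrite mulr_gt0 ?sqrtr_gt0 ?ltr0n.
apply: (le_trans _ (expR_gauss_le z0)).
rewrite expRN exprMn sqr_sqrtr// [_ * n%:R]mulrC lef_pV2 ?posrE ?expR_gt0//.
  exact: expR_le_ratio_sum.
by rewrite ltr_wpDr.
Qed.

End regime_estimates.

(** * The three regimes *)

Theorem theorem8 (R : realType) (mu c : R) (eps : nat -> R)
  (d : nat -> measure_display) (T : forall n, measurableType (d n))
  (P : forall n, probability (T n) R) (q : forall n, {RV (P n) >-> nat})
  (mu_gt0 : 0 < mu) (c_gt0 : 0 < c)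
  (q_steady : forall n, (0 < n)%N -> 0 < eps n < 1 ->
    mmn_steady_state n (n%:R * mu * (1 - eps n)) mu (q n)) :
  (* (a) *)
  (forall alpha : R, 1 / 2 < alpha ->
    (forall n, (0 < n)%N -> eps n = c * n%:R `^ (- alpha)) ->
    [/\ forall n, (0 < n)%N -> 4 * c ^+ 2 < n%:R `^ (2 * alpha - 1) ->
          (P n [set w | (0 < idle n (q n w))%N]
             <= (4 * expR 1 * pi * c * n%:R `^ (- alpha + 1 / 2))%:E)%E,
        P n [set w | (0 < idle n (q n w))%N] @[n --> \oo] --> 0%E
      & exists kappa1 : R, forall n, (0 < n)%N ->
          4 * c ^+ 2 < n%:R `^ (2 * alpha - 1) ->
          forall x : R, 0 <= x ->
          (P n [set w |
              (x < eta_scale n (eps n) * idle_centered n (eps n) (q n w))%R]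
             <= (kappa1 * c / n%:R `^ (alpha - 1 / 2)
                 * expR (- (1 / 2 * x ^+ 2)))%:E)%E]) /\
  (* (b) *)
  ((forall n, (0 < n)%N -> eps n = c * n%:R `^ (- (1 / 2))) ->
    P n [set w | (0 < idle n (q n w))%N] @[n --> \oo] -->
      (Num.sqrt (2 * pi) * c * expR (c ^+ 2 / 2) * std_normal_cdf c
       / (1 + Num.sqrt (2 * pi) * c * expR (c ^+ 2 / 2)
              * std_normal_cdf c))%:E /\
    exists kappa2 : R, forall n, (0 < n)%N -> eps n < 1 ->
      forall x : R, 0 <= x ->
      (P n [set w |
              (x < eta_scale n (eps n) * idle_centered n (eps n) (q n w))%R]
         <= (kappa2 * expR (- (1 / 2 * x ^+ 2)))%:E)%E) /\
  (* (c) *)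
  (forall alpha : R, 0 < alpha < 1 / 2 ->
    (forall n, (0 < n)%N -> eps n = c * n%:R `^ (- alpha)) ->
    [/\ exists kappa3 : R, forall n, (0 < n)%N -> eps n < 1 ->
          ((1 - kappa3 / c * n%:R `^ (alpha - 1 / 2)
                * expR (- (c * n%:R `^ (1 / 2 - alpha))))%:E
             <= P n [set w | (0 < idle n (q n w))%N])%E,
        P n [set w | (0 < idle n (q n w))%N] @[n --> \oo] --> 1%E
      & forall n, (0 < n)%N -> eps n < 1 -> forall x : R, 0 <= x ->
          (P n [set w |
              (x < eta_scale n (eps n) * idle_centered n (eps n) (q n w))%R]
             <= (expR (- (1 / 2 * x ^+ 2)))%:E)%E /\
          (P n [set w |
              (eta_scale n (eps n) * idle_centered n (eps n) (q n w) < - x)%R]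
             <= (expR (- (1 / 2 * x ^+ 2)
                       + 2 * expR 1 * eps n * x ^+ 2))%:E)%E]).
Proof.
have idleE n : (0 < n)%N -> 0 < eps n < 1 ->
    P n [set w | (0 < idle n (q n w))%N] =
    (eps n * ratio_sum n (eps n) / (1 + eps n * ratio_sum n (eps n)))%:E.
  by move=> n0 e01; exact: (mmn_idle_prob n0 mu_gt0 e01 (q_steady n n0 e01)).
have upper n x : (0 < n)%N -> 0 < eps n < 1 -> 0 <= x ->
    (P n [set w |
        (x < eta_scale n (eps n) * idle_centered n (eps n) (q n w))%R]
       <= (expR (- (1 / 2 * x ^+ 2)))%:E)%E.
  move=> n0 e01 x0.
  have [G [/andP[_ G1] _ GP]] := mmn_upper_tail n0 mu_gt0 e01 (q_steady n n0 e01).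
  by apply: le_trans (GP x x0) _; rewrite lee_fin ler_piMl// expR_ge0.
have r1 n : (0 < n)%N -> 1 <= Num.sqrt n%:R :> R.
  by move=> n0; rewrite -[leLHS]sqrtr1 ler_wsqrtr// ler1n.
have eps_gt0 alpha : (forall n, (0 < n)%N -> eps n = c * n%:R `^ (- alpha)) ->
    forall n, (0 < n)%N -> 0 < eps n.
  by move=> epsE n n0; rewrite epsE// mulr_gt0// powR_gt0// ltr0n.
have eps_cvg alpha : 0 < alpha ->
    (forall n, (0 < n)%N -> eps n = c * n%:R `^ (- alpha)) ->
    \forall n \near \oo, eps n < 1.
  move=> a0 epsE; have : c * n%:R `^ (- alpha) @[n --> \oo] --> c * 0.
    by apply: cvgMr; exact: powRN_cvg0.
  rewrite mulr0 => /cvgr_lt /(_ _ (ltr01)); apply: filterS2 (nbhs_infty_gt 0).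
  by move=> n n0 h; rewrite epsE.
split; [|split].
- move=> alpha alpha2 epsE.
  have zE n : (0 < n)%N -> eps n * Num.sqrt n%:R = c * n%:R `^ (- alpha + 1 / 2).
    by move=> n0; rewrite epsE// powR_sqrt.
  (* The condition on [n] is the square of [2 c < n^(alpha - 1/2)], and
     [eps n * sqrt n = c / n^(alpha - 1/2)]. *)
  have z2 n : (0 < n)%N -> 4 * c ^+ 2 < n%:R `^ (2 * alpha - 1) ->
      eps n * Num.sqrt n%:R <= 1 / 2.
    move=> n0 cn; have nR : 0 < n%:R :> R by rewrite ltr0n.
    have pw0 : 0 < n%:R `^ (alpha - 1 / 2) by rewrite powR_gt0.
    rewrite zE// (_ : - alpha + 1 / 2 = - (alpha - 1 / 2)); last ring.
    rewrite powRN ler_pdivrMr//.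
    suff : 2 * c <= n%:R `^ (alpha - 1 / 2) by lra.
    rewrite -(@ler_pXn2r _ 2)// ?nnegrE ?(ltW pw0) ?mulr_ge0 ?(ltW c_gt0)//.
    rewrite -(@powR_mulrn _ (n%:R `^ _)) ?(ltW pw0)// -powRrM.
    have -> : (alpha - 1 / 2) * 2 = 2 * alpha - 1 by field.
    by apply: le_trans (ltW cn); rewrite exprMn -natrX.
  have e_half n : (0 < n)%N -> eps n * Num.sqrt n%:R <= 1 / 2 -> eps n <= 1 / 2.
    move=> n0; apply: le_trans; rewrite ler_peMr ?r1//.
    exact/ltW/(eps_gt0 _ epsE).
  have e01 n : (0 < n)%N -> eps n * Num.sqrt n%:R <= 1 / 2 -> 0 < eps n < 1.
    move=> n0 /(e_half _ n0) h; rewrite (eps_gt0 _ epsE)//=; lra.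
  have bound n : (0 < n)%N -> eps n * Num.sqrt n%:R <= 1 / 2 ->
      (P n [set w | (0 < idle n (q n w))%N]
             <= (4 * expR 1 * pi * c * n%:R `^ (- alpha + 1 / 2))%:E)%E.
    move=> n0 z; rewrite idleE ?e01// lee_fin -[leRHS]mulrA -zE//.
    by apply: odds_le => //; exact: (eps_gt0 _ epsE).
  split.
  + by move=> n n0 cn; apply: bound => //; exact: z2.
  + have pw : c * n%:R `^ (- alpha + 1 / 2) @[n --> \oo] --> c * 0.
      apply: cvgMr; rewrite (_ : - alpha + 1 / 2 = - (alpha - 1 / 2)); last ring.
      by apply: powRN_cvg0; rewrite subr_gt0.
    have up : (4 * expR 1 * pi * (c * n%:R `^ (- alpha + 1 / 2)))%:E
        @[n --> \oo] --> 0%E.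
      apply: cvg_EFin; first exact: nearW.
      have -> : 0 = 4 * expR 1 * pi * (c * 0) :> R by ring.
      exact: cvgMr.
    rewrite mulr0 in pw.
    apply: squeeze_cvge up; last exact: cvg_cst.
    near=> n; rewrite measure_ge0/= mulrA; apply: bound.
      by near: n; exact: nbhs_infty_gt.
    rewrite zE; last by near: n; exact: nbhs_infty_gt.
    by near: n; apply: (cvgr_le 0) => //; rewrite divr_gt0.
  (* The constant of [weight0_bound], applied to the prefactor [G] of the upper tail. *)
  + exists (expR (3 / 2)) => n n0 cn x x0.
    have z := z2 n n0 cn; have e := e01 n n0 z; have /andP[e0 e1] := e.
    have [G [_ GE GP]] := mmn_upper_tail n0 mu_gt0 e (q_steady n n0 e).
    apply: le_trans (GP x x0) _; rewrite lee_fin ler_wpM2r ?expR_ge0//.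
    apply: (le_trans GE).
    have eh : 0 <= eps n <= 1 / 2 by rewrite (ltW e0) e_half.
    apply: le_trans (ler_wpM2l (ltW e0) (weight0_bound n0 eh z)) _.
    rewrite mulrCA zE// (_ : - alpha + 1 / 2 = - (alpha - 1 / 2)); last ring.
    by rewrite powRN mulrA.
- move=> epsE.
  have epsE' n : (0 < n)%N -> eps n = c / Num.sqrt n%:R.
    by move=> n0; rewrite epsE// powR_half.
  have half0 : 0 < 1 / 2 :> R by rewrite divr_gt0.
  split; last first.
    exists 1 => n n0 e1 x x0; rewrite mul1r; apply: upper => //.
    by rewrite (eps_gt0 _ epsE).
  set L := Num.sqrt (2 * pi) * c * expR (c ^+ 2 / 2) * std_normal_cdf c.
  (* This is [eps n * S], the factor [1 / sqrt n] of [eps n] being moved onto the sum. *)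
  pose A n := c * (ratio_sum n (c / Num.sqrt n%:R) / Num.sqrt n%:R).
  have AL : A n @[n --> \oo] --> L.
    rewrite (_ : L = c * (Num.sqrt (2 * pi) * expR (c ^+ 2 / 2) *
      std_normal_cdf c)); last by rewrite /L; ring.
    by apply: cvgMr; exact: ratio_sum_cvg.
  have L0 : 0 <= L.
    rewrite !mulr_ge0 ?sqrtr_ge0 ?expR_ge0 ?(ltW c_gt0)//.
    by rewrite fine_ge0.
  have lim : A n / (1 + A n) @[n --> \oo] --> L / (1 + L).
    apply: cvgM => //; apply: cvgV; first by rewrite gt_eqF// ltr_wpDr.
    by apply: cvgD => //; exact: cvg_cst.
  have : (A n / (1 + A n))%:E @[n --> \oo] --> (L / (1 + L))%:E.
    by apply: cvg_EFin; first exact: nearW.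
  apply: cvg_trans; apply: near_eq_cvg; near=> n.
  have n0 : (0 < n)%N by near: n; exact: nbhs_infty_gt.
  rewrite idleE//; last first.
    by rewrite (eps_gt0 _ epsE)//=; near: n; exact: eps_cvg epsE.
  have -> : eps n * ratio_sum n (eps n) = A n.
    by rewrite /A epsE'//; ring.
  by [].
- move=> alpha /andP[alpha0 alpha2] epsE.
  have zE n : (0 < n)%N -> eps n * Num.sqrt n%:R = c * n%:R `^ (1 / 2 - alpha).
    by move=> n0; rewrite epsE// powR_sqrt// addrC.
  have bound n : (0 < n)%N -> eps n < 1 ->
      1 - expR 2 / c * n%:R `^ (alpha - 1 / 2)
                * expR (- (c * n%:R `^ (1 / 2 - alpha))) <=
      eps n * ratio_sum n (eps n) / (1 + eps n * ratio_sum n (eps n)).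
    move=> n0 e1; have e01 : 0 < eps n < 1 by rewrite (eps_gt0 _ epsE).
    have := lower_odds_ge n0 e01; rewrite zE// invfM.
    by rewrite -powRN opprB mulrA.
  split.
  + exists (expR 2) => n n0 e1.
    by rewrite idleE ?lee_fin ?bound// (eps_gt0 _ epsE).
  (* Bounding the exponential factor by [1] leaves a lower bound that still tends to [1]. *)
  + have low : (1 - expR 2 / c * n%:R `^ (- (1 / 2 - alpha)))%:E
        @[n --> \oo] --> 1%E.
      apply: cvg_EFin; first exact: nearW.
      have : 1 - expR 2 / c * n%:R `^ (- (1 / 2 - alpha)) @[n --> \oo]
          --> 1 - expR 2 / c * 0.
        apply: cvgB; first exact: cvg_cst.
        by apply: cvgMr; apply: powRN_cvg0; rewrite subr_gt0.
      by rewrite mulr0 subr0.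
    apply: (squeeze_cvge _ low (cvg_cst 1%E)).
    near=> n; apply/andP; split; last first.
      by apply: (@probability_le1 _ _ _ (distribution (P n) (q n))
        [set k | (0 < idle n k)%N]).
    have n0 : (0 < n)%N by near: n; exact: nbhs_infty_gt.
    have e1 : eps n < 1 by near: n; exact: eps_cvg epsE.
    rewrite idleE ?(eps_gt0 _ epsE)// lee_fin.
    apply: le_trans (bound n n0 e1); rewrite lerD2l lerN2 opprB.
    rewrite ler_piMr//.
      by rewrite mulr_ge0 ?powR_ge0// divr_ge0 ?expR_ge0// ltW.
    by rewrite expR_le1 oppr_le0 mulr_ge0 ?powR_ge0// ltW.
  + move=> n n0 e1 x x0; have e01 : 0 < eps n < 1 by rewrite (eps_gt0 _ epsE).
    split; first exact: upper.
    apply: le_trans (mmn_lower_tail n0 mu_gt0 e01 (q_steady n n0 e01) x0) _.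
    rewrite lee_fin ler_expR.
    (* The lower tail has exponent [- x^2 / 2 + eps x^2 / 2], and [1 / 2 <= 2 e]. *)
    have : eps n * x ^+ 2 <= expR 1 * (eps n * x ^+ 2).
      rewrite ler_peMl ?mulr_ge0 ?sqr_ge0 ?(ltW (eps_gt0 _ epsE _ n0))//.
      by rewrite -expR0 ler_expR.
    have : 0 <= eps n * x ^+ 2.
      by rewrite mulr_ge0 ?sqr_ge0 ?(ltW (eps_gt0 _ epsE _ n0)).
    lra.
Unshelve. all: by end_near.
Qed.
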